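(* (i) For every Banach Lie algebra $\mathcal{L}$, $$P_{\mathfrak{S}}(\mathcal{L})\subseteq P_{\mathfrak{J}}(\mathcal{L})\subseteq P_{\mathfrak{S}^{\max}}(\mathcal{L})\subseteq P_{\mathfrak{J}^{\max}}(\mathcal{L}),$$ so that $P_{\mathfrak{S}}\leq P_{\mathfrak{J}}\leq P_{\mathfrak{S}^{\max}}\leq P_{\mathfrak{J}^{\max}}$. If $\mathfrak{S}_{\mathcal{L}}\neq\varnothing$ then $P_{\mathfrak{J}^{\max}}(\mathcal{L})\neq\mathcal{L}$. (ii) The radicals $P_{\mathfrak{S}}^{\circ}$, $P_{\mathfrak{J}}^{\circ}$, $P_{\mathfrak{S}^{\max}}^{\circ}$ and $P_{\mathfrak{J}^{\max}}^{\circ}$ coincide, i.e. $P_{\mathfrak{S}}^{\circ}(\mathcal{L})=P_{\mathfrak{J}}^{\circ}(\mathcal{L})=P_{\mathfrak{S}^{\max}}^{\circ}(\mathcal{L})=P_{\mathfrak{J}^{\max}}^{\circ}(\mathcal{L})$ for every Banach Lie algebra $\mathcal{L}$. (iii) For every Banach Lie algebra $\mathcal{L}$, $$r_{P_{\mathfrak{S}}}^{\circ}(\mathcal{L})\leq r_{P_{\mathfrak{J}}}^{\circ}(\mathcal{L})\leq r_{P_{\mathfrak{S}^{\max}}}^{\circ}(\mathcal{L})\leq r_{P_{\mathfrak{J}^{\max}}}^{\circ}(\mathcal{L}).$$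
   Context: A Banach Lie algebra is a complex Lie algebra $\mathcal{L}$ which is a Banach space in some norm such that, for some constant $t_{\mathcal{L}}>0$, $\|[a,b]\|\leq t_{\mathcal{L}}\|a\|\|b\|$ for all $a,b\in\mathcal{L}$. For a Banach Lie algebra $\mathcal{L}$ let: $\mathfrak{S}_{\mathcal{L}}$ be the family of all proper closed Lie subalgebras of finite codimension in $\mathcal{L}$; $\mathfrak{S}^{\max}_{\mathcal{L}}$ the family of all maximal proper closed Lie subalgebras of finite codimension in $\mathcal{L}$; $\mathfrak{J}_{\mathcal{L}}$ the family of all proper closed Lie ideals of finite codimension in $\mathcal{L}$; $\mathfrak{J}^{\max}_{\mathcal{L}}$ the family of all maximal proper closed Lie ideals of finite codimension in $\mathcal{L}$. For $\Gamma\in\{\mathfrak{S},\mathfrak{S}^{\max},\mathfrak{J},\mathfrak{J}^{\max}\}$ put $P_{\Gamma}(\mathcal{L})=\bigcap_{L\in\Gamma_{\mathcal{L}}}L$ if $\Gamma_{\mathcal{L}}\neq\varnothing$, and $P_{\Gamma}(\mathcal{L})=\mathcal{L}$ if $\Gamma_{\mathcal{L}}=\varnothing$. Each $P_\Gamma(\mathcal{L})$ is a closed Lie ideal of $\mathcal{L}$. For maps $R,T$ assigning to each Banach Lie algebra a closed Lie ideal of it, $T\leq R$ means $T(\mathcal{L})\subseteq R(\mathcal{L})$ for all $\mathcal{L}$. For such a map $R$ define by transfinite induction $R^{0}(\mathcal{L})=\mathcal{L}$, $R^{\alpha+1}(\mathcal{L})=R(R^{\alpha}(\mathcal{L}))$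 for an ordinal $\alpha$, and $R^{\alpha}(\mathcal{L})=\bigcap_{\alpha'<\alpha}R^{\alpha'}(\mathcal{L})$ for a limit ordinal $\alpha$. This decreasing transfinite chain stabilizes; $r_R^{\circ}(\mathcal{L})$ denotes the smallest ordinal $\beta$ with $R^{\beta+1}(\mathcal{L})=R^{\beta}(\mathcal{L})$, and $R^{\circ}(\mathcal{L})=R^{\beta}(\mathcal{L})$ for this $\beta$. A preradical is a map $R$ assigning to each Banach Lie algebra $\mathcal{L}$ a closed Lie ideal $R(\mathcal{L})$ with $f(R(\mathcal{L}))\subseteq R(\mathcal{M})$ for each bounded Lie homomorphism $f:\mathcal{L}\to\mathcal{M}$ with dense image; it is a radical if moreover $R(R(\mathcal{L}))=R(\mathcal{L})$, $R(\mathcal{L}/R(\mathcal{L}))=\{0\}$, and $R(I)\subseteq R(\mathcal{L})$ for each closed Lie ideal $I$ of $\mathcal{L}$, for all $\mathcal{L}$. The maps $P_{\Gamma}^{\circ}$ for the four $\Gamma$ above are radicals. *)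

(* Defs.v *)
From HB Require Import structures.
From mathcomp Require Import all_boot all_order all_algebra.
From mathcomp Require Import all_classical all_reals topology normedtype.
From mathcomp Require Import complex.

Set Implicit Arguments.
Unset Strict Implicit.
Unset Printing Implicit Defensive.
Import Order.TTheory GRing.Theory Num.Theory.
Import numFieldNormedType.Exports.
Local Open Scope classical_set_scope.
Local Open Scope ring_scope.

(* Complex Banach Lie algebras are the case K = R[i] with R : realType; the
   norm of the library then takes its (real, nonnegative) values in R[i]. *)

HB.mixin Record CompleteNormedModule_isBanachLie (K : numFieldType) L
    & CompleteNormedModule K L := {
  lie : L -> L -> L;
  lie_linearl : forall (a : K) (x y z : L),
    lie (a *: x + y) z = a *: lie x z + lie y z;
  lie_linearr : forall (a : K) (x y z : L),
    lie x (a *: y + z) = a *: lie x y + lie x z;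
  lie_alt : forall x : L, lie x x = 0;
  lie_jacobi : forall x y z : L,
    lie x (lie y z) + lie y (lie z x) + lie z (lie x y) = 0;
  lie_bounded : exists2 t : K, 0 < t &
    forall x y : L, `|lie x y| <= t * `|x| * `|y|
}.

#[short(type="banachLieType")]
HB.structure Definition BanachLie (K : numFieldType) :=
  {L of CompleteNormedModule K L & CompleteNormedModule_isBanachLie K L}.

Section Subalgebras.
Context {K : numFieldType} {L : banachLieType K}.

Definition lie_subalgebra (A : set L) :=
  [/\ A 0,
      forall (a : K) (x y : L), A x -> A y -> A (a *: x + y) &
      forall x y : L, A x -> A y -> A (lie x y)].

Definition lie_ideal (A : set L) :=
  [/\ A 0,
      forall (a : K) (x y : L), A x -> A y -> A (a *: x + y) &
      forall x y : L, A y -> A (lie x y)].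

(* L / A is spanned by the classes of finitely many vectors *)
Definition finite_codim (A : set L) :=
  exists (n : nat) (v : 'I_n -> L), forall x : L,
    exists c : 'I_n -> K, A (x - \sum_(i < n) c i *: v i).

End Subalgebras.

Record closedSubalg {K : numFieldType} (L : banachLieType K) := ClosedSubalg {
  closedSubalg_set :> set L;
  closedSubalg_closed : closed closedSubalg_set;
  closedSubalgP : lie_subalgebra closedSubalg_set
}.

Lemma closedSubalg_eq (K : numFieldType) (L : banachLieType K)
  (A B : closedSubalg L) : (A : set L) = B -> A = B.
Proof.
case: A B => [A cA sA] [B cB sB] /= eAB.
by move: cB sB; rewrite -eAB => cB sB; congr ClosedSubalg; exact: Prop_irrelevance.
Qed.

(* A closed Lie subalgebra, with the inherited norm and bracket, is itself a
   Banach Lie algebra. *)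

Definition subalg_type {K : numFieldType} {L : banachLieType K}
  (A : closedSubalg L) : Type := {x : L | x \in (A : set L)}.

Section SubalgType.
Context {K : numFieldType} {L : banachLieType K} (A : closedSubalg L).
Local Notation T := (subalg_type A).

HB.instance Definition _ := [isSub of T for @sval _ _].
HB.instance Definition _ := [Choice of T by <:].

Let in_submod : submod_closed (mem (A : set L)).
Proof.
have [A0 Alin _] := closedSubalgP A.
split; first exact/mem_set.
by move=> a x y /set_mem Ax /set_mem Ay; exact/mem_set/Alin.
Qed.

HB.instance Definition _ :=
  GRing.SubChoice_isSubLmodule.Build K L _ T in_submod.

Let norm (x : T) : K := `|val x|.
Let norm_triangle x y : norm (x + y) <= norm x + norm y.
Proof. by rewrite /norm raddfD ler_normD. Qed.
Let normZ (a : K) x : norm (a *: x) = `|a| * norm x.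
Proof. by rewrite /norm linearZ normrZ. Qed.
Let norm_eq0 x : norm x = 0 -> x = 0.
Proof. by move=> /normr0_eq0 x0; apply: val_inj; rewrite x0 raddf0. Qed.

HB.instance Definition _ :=
  Lmodule_isNormed.Build K T norm_triangle normZ norm_eq0.

Lemma subalg_normE (x : T) : `|x| = `|val x|.
Proof. by []. Qed.

Lemma subalg_valP (x : T) : (A : set L) (val x).
Proof. by apply/set_mem; exact: valP x. Qed.

Let complete_T (F : set_system T) : ProperFilter F -> cauchy F -> cvg F.
Proof.
move=> FF /cauchy_ballP Fc.
have [l Fl] : exists l : L, val @ F --> l.
  apply/cvg_ex/(@cauchy_cvg L (val @ F)).
  apply/cauchy_ballP => e e0; have [[P Q] [/= FP FQ] PQ] := Fc e e0.
  exists (val @` P, val @` Q).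
    by split => /=; [apply: filterS FP|apply: filterS FQ] => x ?; exists x.
  move=> [_ _] [[x Px <-] [y Qy <-]]; have /= := PQ (x, y) (conj Px Qy).
  by rewrite -!ball_normE /ball_/= subalg_normE raddfB.
have Al : (A : set L) l.
  apply: (closed_cvg (A : set L) (@closedSubalg_closed _ _ A) _ l Fl).
  by apply: nearW => x; exact: subalg_valP.
apply/cvg_ex; exists (exist _ l (mem_set Al) : T).
apply/fcvgrPdist_lt => e e0.
have /cvgrPdist_lt /(_ e e0) := Fl.
by apply: filterS => x; rewrite subalg_normE raddfB.
Qed.

HB.instance Definition _ := Uniform_isComplete.Build T complete_T.

Let sub_lie (x y : T) : T :=
  exist _ (lie (val x) (val y))
    (mem_set (let: And3 _ _ h := closedSubalgP A in
              h _ _ (subalg_valP x) (subalg_valP y))).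

Let val_lie x y : val (sub_lie x y) = lie (val x) (val y).
Proof. by []. Qed.

Let sub_lie_linearl (a : K) x y z :
  sub_lie (a *: x + y) z = a *: sub_lie x z + sub_lie y z.
Proof.
by apply: val_inj; rewrite val_lie !linearP /= lie_linearl.
Qed.
Let sub_lie_linearr (a : K) x y z :
  sub_lie x (a *: y + z) = a *: sub_lie x y + sub_lie x z.
Proof. by apply: val_inj; rewrite val_lie !linearP /= lie_linearr. Qed.
Let sub_lie_alt x : sub_lie x x = 0.
Proof. by apply: val_inj; rewrite val_lie lie_alt raddf0. Qed.
Let sub_lie_jacobi x y z :
  sub_lie x (sub_lie y z) + sub_lie y (sub_lie z x)
    + sub_lie z (sub_lie x y) = 0.
Proof. by apply: val_inj; rewrite !raddfD raddf0 /= lie_jacobi. Qed.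
Let sub_lie_bounded : exists2 t : K, 0 < t &
  forall x y : T, `|sub_lie x y| <= t * `|x| * `|y|.
Proof.
have [t t0 tP] := @lie_bounded K L.
by exists t => // x y; rewrite !subalg_normE; exact: tP.
Qed.

HB.instance Definition _ := CompleteNormedModule_isBanachLie.Build K T
  sub_lie_linearl sub_lie_linearr sub_lie_alt sub_lie_jacobi sub_lie_bounded.

Lemma subalg_lieE (x y : T) : val (lie x y) = lie (val x) (val y).
Proof. by []. Qed.

End SubalgType.

Section ClosedSubalgOps.
Context {K : numFieldType} {L : banachLieType K}.

Section Inter.
Variable F : set (closedSubalg L).
Let inter := [set x | forall A : closedSubalg L, F A -> (A : set L) x].

Let inter_closed : closed inter.
Proof.
rewrite (_ : inter = \bigcap_(A in F) (A : set L)) //.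
by apply: closed_bigI => A _; exact: (@closedSubalg_closed _ _ A).
Qed.

Let inter_subalgebra : lie_subalgebra inter.
Proof.
split=> [A FA|a x y Fx Fy A FA|x y Fx Fy A FA];
  have [A0 Alin Alie] := closedSubalgP A; [exact: A0|apply: Alin|apply: Alie];
  by [exact: Fx|exact: Fy].
Qed.

Definition subalg_inter : closedSubalg L :=
  ClosedSubalg inter_closed inter_subalgebra.

End Inter.

Section Lift.
Variables (A : closedSubalg L) (B : closedSubalg (subalg_type A)).
Let lift : set L := [set val x | x in (B : set (subalg_type A))].

Let lift_closed : closed lift.
Proof.
move=> x clx.
have Ax : (A : set L) x.
  apply: (@closedSubalg_closed _ _ A) => U /clx [_ [[y By <-] Uy]].
  by exists (val y); split => //; exact: subalg_valP.
exists (exist _ x (mem_set Ax)) => //.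
apply: (@closedSubalg_closed _ _ B) => U /nbhs_ballP[e /= e0 eU].
have [_ [[y By <-] xy]] := clx _ (nbhsx_ballx x e e0).
by exists y; split => //; apply: eU; move: xy;
  rewrite -!ball_normE /ball_/= subalg_normE raddfB.
Qed.

Let lift_subalgebra : lie_subalgebra lift.
Proof.
have [B0 Blin Blie] := closedSubalgP B; split.
- by exists 0 => //; rewrite raddf0.
- move=> a _ _ [x Bx <-] [y By <-]; exists (a *: x + y); first exact: Blin.
  by rewrite linearP.
- move=> _ _ [x Bx <-] [y By <-]; exists (lie x y); first exact: Blie.
  by rewrite subalg_lieE.
Qed.

(* a closed subalgebra of a closed subalgebra A, seen in L *)
Definition subalg_lift : closedSubalg L :=
  ClosedSubalg lift_closed lift_subalgebra.

End Lift.

End ClosedSubalgOps.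

(* A closed Lie ideal is in particular
   a closed Lie subalgebra, so all four families live in [closedSubalg L]. *)

Definition familyS {K : numFieldType} (L : banachLieType K) :
    set (closedSubalg L) :=
  [set A | (A : set L) != setT /\ finite_codim A].

Definition familyJ {K : numFieldType} (L : banachLieType K) :
    set (closedSubalg L) :=
  [set A | [/\ (A : set L) != setT, finite_codim A & lie_ideal A]].

Arguments familyS {K} L.
Arguments familyJ {K} L.

Definition maximal_members {K : numFieldType} {L : banachLieType K}
    (F : set (closedSubalg L)) : set (closedSubalg L) :=
  [set A | F A /\ forall B : closedSubalg L, F B -> A `<=` B -> B = A].

Definition familySmax {K : numFieldType} (L : banachLieType K) :=
  maximal_members (familyS L).

Definition familyJmax {K : numFieldType} (L : banachLieType K) :=
  maximal_members (familyJ L).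

Arguments familySmax {K} L.
Arguments familyJmax {K} L.

(* Closed Lie ideals are closed Lie subalgebras, and only the latter property of
   the values is needed to iterate such a map. *)
Definition lieMap (K : numFieldType) :=
  forall L : banachLieType K, closedSubalg L.

Definition lieMap_le {K : numFieldType} (T R : lieMap K) :=
  forall L : banachLieType K, T L `<=` R L.

(* subalg_inter of an empty family is L, as required when Gamma L is empty *)
Definition P_ {K : numFieldType}
    (Gamma : forall L : banachLieType K, set (closedSubalg L)) : lieMap K :=
  fun L => subalg_inter (Gamma L).

(* An ordinal is a class of well-founded trees of the same rank, the rank of
   [WTree f] being the least ordinal greater than the ranks of all [f i]. *)

Inductive wtree : Type := WTree (T : Type) (f : T -> wtree).

Fixpoint wt_le (a b : wtree) : Prop :=
  match a, b with
  | WTree _ f, WTree _ g => forall i, exists j, wt_le (f i) (g j)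
  end.

Definition wt_lt (a b : wtree) : Prop :=
  match b with WTree _ g => exists j, wt_le a (g j) end.

Definition wt_eqv (a b : wtree) : Prop := wt_le a b /\ wt_le b a.

Lemma wt_leE I (f : I -> wtree) b :
  wt_le (WTree f) b <-> forall i, wt_lt (f i) b.
Proof. by case: b. Qed.

Lemma wt_le_refl a : wt_le a a.
Proof. by elim: a => I f IH /= i; exists i. Qed.

Lemma wt_le_trans b a c : wt_le a b -> wt_le b c -> wt_le a c.
Proof.
elim: a b c => I f IH [J g] [H h] ab bc i.
by have [j fg] := ab i; have [k gh] := bc j; exists k; exact: IH fg gh.
Qed.

Lemma wt_lt_le_trans b a c : wt_lt a b -> wt_le b c -> wt_lt a c.
Proof.
case: b c => J g [H h] [j aj] bc; have [k gk] := bc j.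
by exists k; exact: wt_le_trans gk.
Qed.

Lemma wt_le_lt_trans b a c : wt_le a b -> wt_lt b c -> wt_lt a c.
Proof. by case: c => H h ab [k bk]; exists k; exact: wt_le_trans bk. Qed.

Lemma wt_ltW a b : wt_lt a b -> wt_le a b.
Proof.
elim: a b => I f IH [J g] [j aj] i; exists j.
by apply: IH; apply: wt_lt_le_trans aj; exists i; exact: wt_le_refl.
Qed.

Lemma wt_le_total a b : wt_le a b \/ wt_lt b a.
Proof.
elim: a b => I f IH b.
have [fb|/existsNP[i nfi]] := pselect (forall i, wt_lt (f i) b).
  by left; apply/wt_leE.
right; exists i; case: b nfi => J g nfi.
apply/wt_leE => j; have [hg|//] := IH i (g j).
by case: nfi; exists j.
Qed.

Lemma wt_lt_wf : well_founded wt_lt.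
Proof.
suff H a b : wt_le b a -> Acc wt_lt b by move=> a; exact: H (wt_le_refl a).
elim: a b => I f IH b ba; constructor => c cb.
by have [i ci] := wt_lt_le_trans cb ba; exact: IH ci.
Qed.

Lemma wt_eqv_refl a : wt_eqv a a.
Proof. by split; exact: wt_le_refl. Qed.

Lemma wt_eqvE a b : wt_eqv a b -> wt_eqv a = wt_eqv b.
Proof.
move=> [ab ba]; apply/funext => c; apply/propext; split=> -[p q].
  by split; [exact: wt_le_trans ba p|exact: wt_le_trans q ab].
by split; [exact: wt_le_trans ab p|exact: wt_le_trans q ba].
Qed.

Record ordinal_number : Type := OrdinalNumber {
  ord_class : wtree -> Prop;
  ord_classP : exists a, ord_class = wt_eqv a
}.

Definition ord_of (a : wtree) : ordinal_number :=
  OrdinalNumber (ex_intro (fun b => wt_eqv a = wt_eqv b) a erefl).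

Definition ord_le (x y : ordinal_number) :=
  exists a b, [/\ ord_class x a, ord_class y b & wt_le a b].

Definition ord_lt (x y : ordinal_number) :=
  exists a b, [/\ ord_class x a, ord_class y b & wt_lt a b].

Lemma ord_eq x y : ord_class x = ord_class y -> x = y.
Proof.
case: x y => [x xP] [y yP] /= exy.
by move: yP; rewrite -exy => yP; congr OrdinalNumber; exact: Prop_irrelevance.
Qed.

Lemma ord_of_surj x : exists a, x = ord_of a.
Proof. by case: (ord_classP x) => a xa; exists a; exact: ord_eq. Qed.

Lemma ord_of_eq a b : ord_of a = ord_of b <-> wt_eqv a b.
Proof.
split=> [[ab]|/wt_eqvE ab]; last exact: ord_eq.
by rewrite ab; exact: wt_eqv_refl.
Qed.

Lemma ord_leE a b : ord_le (ord_of a) (ord_of b) <-> wt_le a b.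
Proof.
split=> [[a' [b' [/= [aa' _] [_ b'b] ab']]]|ab].
  exact: wt_le_trans aa' (wt_le_trans ab' b'b).
by exists a, b; split => //; exact: wt_eqv_refl.
Qed.

Lemma ord_ltE a b : ord_lt (ord_of a) (ord_of b) <-> wt_lt a b.
Proof.
split=> [[a' [b' [/= [aa' _] [_ b'b] ab']]]|ab].
  exact: wt_le_lt_trans aa' (wt_lt_le_trans ab' b'b).
by exists a, b; split => //; exact: wt_eqv_refl.
Qed.

Lemma ord_le_refl x : ord_le x x.
Proof. by have [a ->] := ord_of_surj x; apply/ord_leE; exact: wt_le_refl. Qed.

Lemma ord_le_trans y x z : ord_le x y -> ord_le y z -> ord_le x z.
Proof.
have [a ->] := ord_of_surj x; have [b ->] := ord_of_surj y.
have [c ->] := ord_of_surj z => /ord_leE ab /ord_leE bc.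
by apply/ord_leE; exact: wt_le_trans bc.
Qed.

Lemma ord_le_anti x y : ord_le x y -> ord_le y x -> x = y.
Proof.
have [a ->] := ord_of_surj x; have [b ->] := ord_of_surj y.
by move=> /ord_leE ab /ord_leE ba; apply/ord_of_eq.
Qed.

Lemma ord_lt_wf : well_founded ord_lt.
Proof.
move=> x; have [a ->] := ord_of_surj x.
elim: (wt_lt_wf a) => {}a _ IH; constructor => y.
by have [b ->] := ord_of_surj y => /ord_ltE; exact: IH.
Qed.

Lemma ord_lt_irr x : ~ ord_lt x x.
Proof. by elim: (ord_lt_wf x) => {}x _ IH lt_xx; exact: (IH x). Qed.

Lemma ord_leNlt x y : ord_le x y <-> ~ ord_lt y x.
Proof.
have [a ->] := ord_of_surj x; have [b ->] := ord_of_surj y.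
split=> [/ord_leE ab /ord_ltE ba|nba].
  by have /ord_ltE/ord_lt_irr := wt_le_lt_trans ab ba.
by apply/ord_leE; have [//|/ord_ltE] := wt_le_total a b.
Qed.

Lemma ord_lt_trans y x z : ord_lt x y -> ord_lt y z -> ord_lt x z.
Proof.
have [a ->] := ord_of_surj x; have [b ->] := ord_of_surj y.
have [c ->] := ord_of_surj z => /ord_ltE ab /ord_ltE bc.
by apply/ord_ltE; exact: wt_lt_le_trans ab (wt_ltW bc).
Qed.

Definition ord_succ_of (x y : ordinal_number) :=
  ord_lt x y /\ forall z, ord_lt x z -> ord_le y z.

Lemma ord_succ_ex x : exists y, ord_succ_of x y.
Proof.
have [a ->] := ord_of_surj x.
exists (ord_of (WTree (fun _ : unit => a))); split.
  by apply/ord_ltE; exists tt; exact: wt_le_refl.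
move=> z; have [c ->] := ord_of_surj z => /ord_ltE ac.
by apply/ord_leE/wt_leE.
Qed.

Definition ord_succ x := sval (cid (ord_succ_ex x)).

Lemma ord_succP x : ord_succ_of x (ord_succ x).
Proof. exact: svalP (cid _). Qed.

Lemma ord_lt_succ x : ord_lt x (ord_succ x).
Proof. by have [] := ord_succP x. Qed.

Lemma ord_succ_le x z : ord_lt x z -> ord_le (ord_succ x) z.
Proof. by have [_] := ord_succP x; apply. Qed.

Lemma ord_lt_trichotomy x y : [\/ ord_lt x y, x = y | ord_lt y x].
Proof.
have [xy|xy] := pselect (ord_lt x y); first by constructor 1.
have [yx|yx] := pselect (ord_lt y x); first by constructor 3.
by constructor 2; apply: ord_le_anti; apply/ord_leNlt.
Qed.

Lemma ord_succ_inj x y : ord_succ x = ord_succ y -> x = y.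
Proof.
move=> exy; have [xy|//|yx] := ord_lt_trichotomy x y.
  have := ord_succ_le xy; rewrite exy => /ord_leNlt[]; exact: ord_lt_succ.
have := ord_succ_le yx; rewrite -exy => /ord_leNlt[]; exact: ord_lt_succ.
Qed.

Section Iteration.
Context {K : numFieldType}.
Variable R : lieMap K.
Variable L : banachLieType K.

(* R(A), for A with its own Banach Lie algebra structure, as a subset of L *)
Definition map_on (A : closedSubalg L) : closedSubalg L :=
  subalg_lift (R (subalg_type A)).

(* An ordinal that is not a successor is 0 or a limit; for 0 the intersection is
   empty, hence equal to L (see iter_pow0, iter_pow_succ, iter_pow_limit). *)
Definition iter_step (x : ordinal_number)
    (rec : forall y, ord_lt y x -> closedSubalg L) : closedSubalg L :=
  match pselect (exists y, x = ord_succ y) with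
  | left ex =>
      let y := sval (cid ex) in
      map_on (rec y (eq_rect_r (ord_lt y) (ord_lt_succ y) (svalP (cid ex))))
  | right _ =>
      subalg_inter [set A | exists y (yx : ord_lt y x), A = rec y yx]
  end.

(* R^x(L) *)
Definition iter_pow : ordinal_number -> closedSubalg L :=
  Fix ord_lt_wf (fun _ => closedSubalg L) iter_step.

Lemma iter_powE x : iter_pow x = iter_step (fun y (_ : ord_lt y x) => iter_pow y).
Proof.
apply: (Fix_eq ord_lt_wf (fun _ => closedSubalg L)) => y f g fg.
by have -> : f = g by apply: functional_extensionality_dep => z; apply: funext.
Qed.

Lemma iter_pow_succ x : iter_pow (ord_succ x) = map_on (iter_pow x).
Proof.
rewrite iter_powE /iter_step; case: pselect => [ex|[]]; last by exists x.
by congr (map_on (iter_pow _)); case: cid => y /= /ord_succ_inj.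
Qed.

Lemma iter_pow_limit x : (forall y, x <> ord_succ y) ->
  (iter_pow x : set L) = [set v | forall y, ord_lt y x -> (iter_pow y : set L) v].
Proof.
move=> xlim; rewrite iter_powE /iter_step; case: pselect => [[y /xlim//]|_].
apply/seteqP; split=> v /= h; first by move=> y yx; apply: h; exists y, yx.
by move=> _ [y [yx ->]]; exact: h.
Qed.

Lemma iter_pow0 x : (forall y, ~ ord_lt y x) -> (iter_pow x : set L) = setT.
Proof.
move=> x0; rewrite iter_pow_limit => [|y xy].
  by apply/seteqP; split => // v _ y /x0.
by apply: (x0 y); rewrite xy; exact: ord_lt_succ.
Qed.

Lemma map_on_sub A : map_on A `<=` A.
Proof. by move=> _ [v _ <-]; exact: subalg_valP. Qed.

Lemma iter_pow_sub x y : ord_le x y -> iter_pow y `<=` iter_pow x.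
Proof.
elim: (ord_lt_wf y) x => {}y _ IH x xy.
have [yx|<-//|{}xy] := ord_lt_trichotomy y x; first by case/ord_leNlt: xy.
have [[z yz]|ny] := pselect (exists z, y = ord_succ z).
  have zy : ord_lt z y by rewrite yz; exact: ord_lt_succ.
  rewrite yz iter_pow_succ; apply: (subset_trans (@map_on_sub _)).
  apply: IH => //; apply/ord_leNlt => /ord_succ_le; rewrite -yz => /ord_leNlt.
  exact.
rewrite (iter_pow_limit (x := y)); last by move=> z yz; apply: ny; exists z.
by move=> v; apply.
Qed.

Definition stable_at (x : ordinal_number) :=
  iter_pow (ord_succ x) = iter_pow x.

Lemma stable_ex : exists x, stable_at x.
Proof.
apply: contrapT => nst.
have inj x y : iter_pow x = iter_pow y -> ord_le y x.
  move=> exy; apply/ord_leNlt => xy; apply: nst; exists x.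
  apply: closedSubalg_eq; apply/seteqP; split.
    by apply: iter_pow_sub; apply/ord_leNlt => /ord_lt_trans/(_ (ord_lt_succ x)) /ord_lt_irr.
  by rewrite exy; apply: iter_pow_sub; exact: ord_succ_le.
pose a (A : {A : closedSubalg L | exists t, A = iter_pow (ord_of t)}) :=
  sval (cid (svalP A)).
pose x := ord_of (WTree a).
have xA : exists t, iter_pow x = iter_pow (ord_of t) by exists (WTree a).
pose s := exist (fun A => exists t, A = iter_pow (ord_of t)) (iter_pow x) xA.
have /esym/inj/ord_leNlt : iter_pow x = iter_pow (ord_of (a s)).
  exact: (svalP (cid (svalP s))).
by apply; apply/ord_ltE; exists s; exact: wt_le_refl.
Qed.

Lemma stable_min : exists x, stable_at x /\ forall y, stable_at y -> ord_le x y.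
Proof.
have [x] := stable_ex; elim: (ord_lt_wf x) => {}x _ IH xst.
have [[y [yx yst]]|nex] := pselect (exists y, ord_lt y x /\ stable_at y).
  exact: (IH y).
exists x; split=> // y yst; apply/ord_leNlt => yx.
by apply: nex; exists y.
Qed.

(* r_R^o(L) *)
Definition stab_index : ordinal_number := sval (cid stable_min).

Lemma stab_indexP :
  stable_at stab_index /\ forall y, stable_at y -> ord_le stab_index y.
Proof. exact: svalP (cid stable_min). Qed.

(* R^o(L) *)
Definition iter_stable : closedSubalg L := iter_pow stab_index.

End Iteration.

(* Main.v *)
(* The heart of the matter is that a maximal closed subalgebra M of finite
   codimension contains a closed ideal of finite codimension. Let
   L = F 0 >= M = F 1 >= F 2 >= ... where F (n+1) consists of the z in M with
   [L, z] <= F n. If the chain stabilises, its last term is such an ideal.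
   Otherwise, for z in F n, the element [y_1, [..., [y_n, z]]] modulo M is
   symmetric in the y_i and vanishes when some y_i lies in M: the symmetric
   algebra of L / M acts on the dual of the graded space of F. Let P be the
   largest subspace of L containing M whose elements act nilpotently. If h in M
   has an eigenvector x in L / P of eigenvalue a <> 0 and x is not nilpotent, then
   h has eigenvalues mu - n a, for all n, on subquotients of L, which contradicts
   the boundedness of ad h; hence x is nilpotent, so x lies in P. Thus M acts on
   L / P by nilpotent operators, and Engel's theorem gives a functional f <> 0
   with f(M) = f([M, L]) = 0. The stabiliser of f contains M. If it is L, then
   M = ker f is an ideal; if it is M, then f([x, y]) is a symplectic form on L / M,
   so f = f([v, _]) with [M, v] <= M, hence L = M + K v and f(v) = f([v, v]) = 0, a
   contradiction.

   The inclusion P_Smax <= P_Jmax and the fact that P_Smax of an ideal is again an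
   ideal come from the invariance of the set of maximal subalgebras under the
   automorphisms exp(D), for D a bounded derivation. For (iii), P_S and P_J are
   monotone along inclusions and P_Jmax along inclusions of ideals, which
   compares the transfinite iterates; for (ii), all the stable iterates are the
   largest closed subalgebra without proper closed subalgebras of finite
   codimension. *)
Require Import Defs.
From mathcomp Require Import all_boot all_order all_algebra.
From mathcomp Require Import all_classical all_reals topology normedtype.
From mathcomp Require Import complex.
From mathcomp Require Import ring.
Set Implicit Arguments.
Unset Strict Implicit.
Unset Printing Implicit Defensive.
Import Order.TTheory GRing.Theory Num.Theory.
Import numFieldNormedType.Exports.
Local Open Scope classical_set_scope.
Local Open Scope complex_scope.
Local Open Scope ring_scope.

(** * Identities between linear combinations *)

(** Reflected linear combinations: the vector atoms are numbered, so that an identity between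
    vectors reduces to one [ring] identity per atom. *)
Inductive mexpr (K : Type) :=
| MZero
| MAtom of nat
| MAdd of mexpr K & mexpr K
| MOpp of mexpr K
| MScale of K & mexpr K.

Arguments MZero {K}.
Arguments MAtom {K} _.

Section LinearCombinations.
Context {K : pzRingType} {V : lmodType K}.
Implicit Types (e : mexpr K) (env : seq V).

Fixpoint meval env e : V :=
  match e with
  | MZero => 0
  | MAtom n => nth 0 env n
  | MAdd e1 e2 => meval env e1 + meval env e2
  | MOpp e1 => - meval env e1
  | MScale a e1 => a *: meval env e1
  end.

Fixpoint mcoef e (i : nat) : K :=
  match e with
  | MZero => 0
  | MAtom n => if n == i then 1 else 0
  | MAdd e1 e2 => mcoef e1 i + mcoef e2 i
  | MOpp e1 => - mcoef e1 i
  | MScale a e1 => a * mcoef e1 i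
  end.

Fixpoint same_coefs n e1 e2 : Prop :=
  if n is n'.+1 then mcoef e1 n' = mcoef e2 n' /\ same_coefs n' e1 e2 else True.

Lemma mevalE env e : meval env e = \sum_(i < size env) mcoef e i *: nth 0 env i.
Proof.
elim: e => [|n|e1 IH1 e2 IH2|e1 IH1|a e1 IH1] /=; rewrite ?IH1 ?IH2.
- by rewrite big1 // => i _; rewrite scale0r.
- have [nlt|nge] := ltnP n (size env).
    rewrite (bigD1 (Ordinal nlt)) //= eqxx scale1r big1 ?addr0 // => i.
    by rewrite -val_eqE /= eq_sym => /negbTE ->; rewrite scale0r.
  rewrite nth_default // big1 // => i _.
  by rewrite gtn_eqF ?scale0r // (leq_trans (ltn_ord i)).
- by rewrite -big_split; apply: eq_bigr => i _; rewrite scalerDl.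
- by rewrite -sumrN; apply: eq_bigr => i _; rewrite scaleNr.
- by rewrite scaler_sumr; apply: eq_bigr => i _; rewrite scalerA.
Qed.

Lemma meval_eq env e1 e2 :
  same_coefs (size env) e1 e2 -> meval env e1 = meval env e2.
Proof.
move=> h; rewrite !mevalE; apply: eq_bigr => i _; congr (_ *: _).
elim: (size env) h i => [_ [//]|n IH /= [h0 hn] [i /=]].
rewrite ltnS leq_eqVlt => /orP[/eqP -> //|lin].
exact: (IH hn (Ordinal lin)).
Qed.

End LinearCombinations.

(** Unification is tried after syntactic equality, because one vector may occur under several
    convertible forms. *)
Ltac same_atom x y :=
  match goal with
  | _ => let _ := match goal with _ => constr_eq x y end in constr:(true)
  | _ => let _ := match goal with _ => unify x y end in constr:(true)
  | _ => constr:(false)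
  end.

Ltac madd_atom x env :=
  let rec go l :=
    match l with
    | nil => constr:(cons x nil)
    | cons ?y ?l' =>
        let t := same_atom x y in
        match t with
        | true => l
        | false => let r := go l' in constr:(cons y r)
        end
    end in go env.

Ltac matoms env t :=
  match t with
  | GRing.add ?a ?b => let env := matoms env a in matoms env b
  | GRing.opp ?a => matoms env a
  | GRing.scale _ ?a => matoms env a
  | GRing.zero => env
  | _ => madd_atom t env
  end.

Ltac mindex x env :=
  match env with
  | cons ?y ?l =>
      let t := same_atom x y in
      match t with
      | true => constr:(0%N)
      | false => let n := mindex x l in constr:(S n)
      end
  end.

Ltac mquote K env t :=
  match t with
  | GRing.add ?a ?b =>
      let a := mquote K env a in let b := mquote K env b in
      constr:(@MAdd K a b)
  | GRing.opp ?a => let a := mquote K env a in constr:(@MOpp K a)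
  | GRing.scale ?c ?a => let a := mquote K env a in constr:(@MScale K c a)
  | GRing.zero => constr:(@MZero K)
  | _ => let n := mindex t env in constr:(@MAtom K n)
  end.

(* proves an equality of linear combinations with coefficients in [K] *)
Ltac lincomb K :=
  match goal with
  | |- @eq ?V ?a ?b =>
      let env := matoms (@nil V) a in
      let env := matoms env b in
      let ea := mquote K env a in
      let eb := mquote K env b in
      refine (@meval_eq K _ env ea eb _);
      cbn [same_coefs mcoef size eqn]; repeat split; rewrite /=; ring
  end.

(** * Subspaces of finite codimension *)

Definition linear_map {K : pzRingType} {U V : lmodType K} (f : U -> V) :=
  forall (a : K) (x y : U), f (a *: x + y) = a *: f x + f y.

Section LinearMap.
Context {K : pzRingType} {U V : lmodType K} {f : U -> V} (fl : linear_map f).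

Lemma lin0 : f 0 = 0.
Proof. by have := fl (-1) 0 0; rewrite scaler0 addr0 scaleN1r addNr. Qed.

Lemma linD x y : f (x + y) = f x + f y.
Proof. by have := fl 1 x y; rewrite !scale1r. Qed.

Lemma linZ a x : f (a *: x) = a *: f x.
Proof. by have := fl a x 0; rewrite !addr0 lin0 addr0. Qed.

Lemma linN x : f (- x) = - f x.
Proof. by rewrite -scaleN1r linZ scaleN1r. Qed.

Lemma linB x y : f (x - y) = f x - f y.
Proof. by rewrite linD linN. Qed.

Lemma lin_sum (I : Type) (r : seq I) (P : pred I) (F : I -> U) :
  f (\sum_(i <- r | P i) F i) = \sum_(i <- r | P i) f (F i).
Proof.
elim: r => [|i r IH]; first by rewrite !big_nil lin0.
by rewrite !big_cons; case: ifP => _ //; rewrite linD IH.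
Qed.

End LinearMap.

Lemma lin_iter {K : pzRingType} {U : lmodType K} (f : U -> U) n :
  linear_map f -> linear_map (iter n f).
Proof. by move=> fl; elim: n => [|n IH] a x y //=; rewrite IH fl. Qed.

Lemma iter_fixed {K : pzRingType} {U : lmodType K} (f : U -> U) (A : set U) n x :
  (forall y, A y -> A (f y)) -> A x -> A (iter n f x).
Proof. by move=> fA Ax; elim: n => //= n; exact: fA. Qed.

Definition linear_subspace {K : pzRingType} {V : lmodType K} (A : set V) :=
  A 0 /\ forall (a : K) (x y : V), A x -> A y -> A (a *: x + y).

Section Subspace.
Context {K : pzRingType} {V : lmodType K} {A : set V} (sA : linear_subspace A).

Lemma sub0 : A 0. Proof. by case: sA. Qed.

Lemma subZ a x : A x -> A (a *: x).
Proof. by move=> Ax; rewrite -[_ *: _]addr0; apply: sA.2 => //; exact: sub0. Qed.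

Lemma subD x y : A x -> A y -> A (x + y).
Proof. by move=> Ax Ay; rewrite -[x]scale1r; exact: sA.2. Qed.

Lemma subN x : A x -> A (- x).
Proof. by move=> Ax; rewrite -scaleN1r; exact: subZ. Qed.

Lemma subB x y : A x -> A y -> A (x - y).
Proof. by move=> Ax Ay; apply: subD => //; exact: subN. Qed.

Lemma sub_sum (I : Type) (r : seq I) (P : pred I) (F : I -> V) :
  (forall i, P i -> A (F i)) -> A (\sum_(i <- r | P i) F i).
Proof. by move=> AF; apply: big_ind => //; [exact: sub0|exact: subD]. Qed.

End Subspace.

Lemma subspace_preim {K : pzRingType} {U V : lmodType K} (f : U -> V)
  (A : set V) : linear_map f -> linear_subspace A -> linear_subspace [set x | A (f x)].
Proof.
move=> fl sA; split; first by rewrite /= (lin0 fl); exact: sub0 sA.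
by move=> a x y /= Ax Ay; rewrite fl; exact: sA.2.
Qed.

Lemma subspaceI {K : pzRingType} {V : lmodType K} (A B : set V) :
  linear_subspace A -> linear_subspace B -> linear_subspace (A `&` B).
Proof.
move=> sA sB; split; first by split; exact: sub0.
by move=> a x y [Ax Bx] [Ay By]; split; [exact: sA.2|exact: sB.2].
Qed.

Lemma subspaceT {K : pzRingType} {V : lmodType K} : linear_subspace [set: V].
Proof. by []. Qed.

Definition addl {K : pzRingType} {V : lmodType K} (A : set V) (v : V) : set V :=
  [set x | exists (c : K) y, A y /\ x = y + c *: v].

Section Addl.
Context {K : pzRingType} {V : lmodType K} {A : set V} (sA : linear_subspace A).

Lemma subspace_addl v : linear_subspace (addl A v).
Proof.
split; first by exists 0, 0; rewrite scale0r addr0; split => //; exact: sub0.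
move=> a _ _ [c [x [Ax ->]]] [d [y [Ay ->]]].
exists (a * c + d), (a *: x + y); split; first exact: sA.2.
by rewrite scalerDr scalerA scalerDl addrACA.
Qed.

Lemma sub_addl v : A `<=` addl A v.
Proof. by move=> x Ax; exists 0, x; rewrite scale0r addr0. Qed.

Lemma addl_self v : addl A v v.
Proof. by exists 1, 0; rewrite scale1r add0r; split => //; exact: sub0. Qed.

End Addl.

(** A vector of [U] outside the row space of [S] raises the rank when added to it, and ranks are at
    most [n]; the process therefore stops at a row space equal to [U]. *)
Lemma set_rowspace (K : fieldType) n (U : set 'rV[K]_n) :
  linear_subspace U -> exists S : 'M[K]_n, forall r, U r <-> (r <= S)%MS.
Proof.
move=> sU.
suff H k : (exists S : 'M[K]_n, forall r, U r <-> (r <= S)%MS) \/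
    exists S : 'M[K]_n, (k <= \rank S)%N /\ forall r : 'rV_n, (r <= S)%MS -> U r.
  have [//|[S [/leq_trans/(_ (rank_leq_row S))]]] := H n.+1.
  by rewrite ltnn.
elim: k => [|k [|[S [kS SU]]]]; [right|by left|].
  exists 0; split => // r; rewrite submx0 => /eqP ->; exact: sub0 sU.
have [US|/existsNP[r nr]] := pselect (forall r, U r -> (r <= S)%MS).
  by left; exists S => r; split; [exact: US|exact: SU].
have [Ur rS] : U r /\ ~ (r <= S)%MS by apply: contrapT => h; apply: nr => Ur; apply: contrapT => rS; apply: h.
right; exists (S + r)%MS; split.
  apply: leq_ltn_trans kS _; apply: rank_ltmx.
  rewrite ltmxE addsmxSl /=; apply/negP => /(submx_trans (addsmxSr S r)).
  exact: rS.
move=> x /sub_addsmxP[[u v] /= ->]; apply: subD => //.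
  by apply: SU; exact: submxMl.
by rewrite [v]mx11_scalar mul_scalar_mx; exact: subZ.
Qed.

Section FiniteCodim.
Context {K : numFieldType} {L : banachLieType K}.
Implicit Types A B : set L.

Lemma finite_codim_sub A B : A `<=` B -> finite_codim A -> finite_codim B.
Proof.
move=> AB [n [v vP]]; exists n, v => x; have [c cP] := vP x.
by exists c; exact: AB.
Qed.

(** Coordinates modulo [A] that are chosen vector by vector need not be linear. They are determined
    up to the row space of [S], the coordinate vectors whose combination lies in [A], and
    multiplication by the cokernel of [S] removes this ambiguity. *)
Lemma finite_codim_kernel A : linear_subspace A -> finite_codim A ->
  exists n (g : L -> 'rV[K]_n), linear_map g /\ forall x, A x <-> g x = 0.
Proof.
move=> sA [n [v vP]].
pose comb (r : 'rV[K]_n) := \sum_(i < n) r 0 i *: v i.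
have combl : linear_map comb.
  move=> a r s; rewrite /comb scaler_sumr -big_split; apply: eq_bigr => i _ /=.
  by rewrite !mxE scalerDl scalerA.
have [S SP] := set_rowspace (subspace_preim combl sA).
have cP x : exists c : 'rV[K]_n, A (x - comb c).
  have [c cP] := vP x; exists (\row_i c i); rewrite /comb.
  by under eq_bigr do rewrite mxE.
pose c x := sval (cid (cP x)).
have cA x : A (x - comb (c x)) := svalP (cid (cP x)).
exists n, (fun x => c x *m cokermx S); split.
  move=> a x y; rewrite scalemxAl -mulmxDl; apply/eqP; rewrite -subr_eq0.
  rewrite -mulmxBl -submxE; apply/SP => /=.
  rewrite (linB combl) combl.
  have := subB sA (sA.2 a _ _ (cA x) (cA y)) (cA (a *: x + y)).
  by congr A; lincomb K.
move=> x; split=> [Ax|/eqP].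
  apply/eqP; rewrite -submxE; apply/SP => /=.
  by have := subB sA Ax (cA x); congr A; lincomb K.
rewrite -submxE => /SP /= Ac.
by have := subD sA (cA x) Ac; congr A; lincomb K.
Qed.

Lemma kernel_finite_codim A n (g : L -> 'rV[K]_n) :
  linear_map g -> (forall x, g x = 0 -> A x) -> finite_codim A.
Proof.
move=> gl gA.
have sU : linear_subspace [set g x | x in [set: L]].
  split; first by exists 0; rewrite ?(lin0 gl).
  by move=> a _ _ [x _ <-] [y _ <-]; exists (a *: x + y); rewrite ?gl.
have [S SP] := set_rowspace sU.
have wP i : exists x, g x = row i S.
  by have /SP[x _ gx] := row_sub i S; exists x.
exists n, (fun i => sval (cid (wP i))) => x.
have /SP/submxP[r gx] : (range g) (g x) by exists x.
exists (fun i => r 0 i); apply: gA; rewrite (linB gl) (lin_sum gl) gx mulmx_sum_row.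
apply/eqP; rewrite subr_eq0; apply/eqP; apply: eq_bigr => i _.
by rewrite (linZ gl) (svalP (cid (wP i))).
Qed.

Lemma finite_codimI A B : linear_subspace A -> linear_subspace B ->
  finite_codim A -> finite_codim B -> finite_codim (A `&` B).
Proof.
move=> sA sB fA fB.
have [n [g [gl gP]]] := finite_codim_kernel sA fA.
have [m [h [hl hP]]] := finite_codim_kernel sB fB.
apply: (@kernel_finite_codim _ _ (fun x => row_mx (g x) (h x))).
  by move=> a x y; rewrite gl hl scale_row_mx add_row_mx.
move=> x; rewrite -row_mx0 => /eq_row_mx[/gP ? /hP ?]; by [].
Qed.

Lemma finite_codimT : finite_codim [set: L].
Proof. by exists 0%N, (fun=> 0) => x; exists (fun=> 0). Qed.

Lemma finite_codim_bigI (I : finType) (A : I -> set L) :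
  (forall i, linear_subspace (A i)) -> (forall i, finite_codim (A i)) ->
  finite_codim [set x | forall i, A i x].
Proof.
move=> sA fA.
suff : finite_codim [set x | forall i, i \in enum I -> A i x].
  by move=> h; apply: finite_codim_sub h => x h i; apply: h; rewrite mem_enum.
have sE (s : seq I) : linear_subspace [set x | forall i, i \in s -> A i x].
  split=> [i _|a x y Ax Ay i si]; first exact: sub0.
  by apply: (sA i).2; [exact: Ax|exact: Ay].
elim: (enum I) => [|i s IH].
  by apply: finite_codim_sub finite_codimT => x _ i.
have := finite_codimI (sA i) (sE s) (fA i) IH.
by apply: finite_codim_sub => x [Ai As] j; rewrite inE => /predU1P[-> //|]; exact: As.
Qed.

(** Plays the role of Zorn's lemma: [g] identifies the subspaces containing [A] with subspaces of a
    space of dimension at most n, so passing to a strictly larger member of [Phi] raises a rank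
    bounded by n. *)
Lemma max_subspace A (Phi : set (set L)) B0 :
  linear_subspace A -> finite_codim A ->
  (forall B, Phi B -> linear_subspace B /\ A `<=` B) -> Phi B0 ->
  exists B, [/\ Phi B, B0 `<=` B & forall C, Phi C -> B `<=` C -> C = B].
Proof.
move=> sA fA PhiS PhiB0; have [n [g [gl gP]]] := finite_codim_kernel sA fA.
suff H k : (exists B, [/\ Phi B, B0 `<=` B & forall C, Phi C -> B `<=` C -> C = B])
    \/ exists B (S : 'M[K]_n), [/\ Phi B, B0 `<=` B, (k <= \rank S)%N &
         forall r : 'rV_n, (r <= S)%MS -> exists2 x, B x & g x = r].
  have [//|[B [S [_ _ /leq_trans/(_ (rank_leq_row S))]]]] := H n.+1.
  by rewrite ltnn.
elim: k => [|k [|[B [S [PB B0B kS SB]]]]]; [right|by left|].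
  exists B0, 0; split => // r; rewrite submx0 => /eqP ->; exists 0.
    by have [sB _] := PhiS _ PhiB0; exact: sub0.
  exact: lin0.
have [Bmax|/existsNP[C nC]] := pselect (forall C, Phi C -> B `<=` C -> C = B).
  by left; exists B.
have [PC [BC CB]] : Phi C /\ B `<=` C /\ ~ C `<=` B.
  split; first by apply: contrapT => h; apply: nC.
  by split; apply: contrapT => h; apply: nC => // *; apply/seteqP; split=> //; apply: contrapT.
have [x nx] : exists x, ~ (C x -> B x) by apply/existsNP.
have {nx}[Cx Bx] : C x /\ ~ B x.
  by split; [apply: contrapT => h; apply: nx|move=> h; apply: nx].
have [[sB AB] [sC AC]] := (PhiS _ PB, PhiS _ PC).
right; exists C, (S + g x)%MS; split => //; first exact: subset_trans BC.
  apply: leq_ltn_trans kS _; apply: rank_ltmx.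
  rewrite ltmxE addsmxSl /=; apply/negP => /(submx_trans (addsmxSr S (g x))).
  move=> /SB[y By gxy]; apply: Bx; rewrite -[x](subrK y); apply: subD => //.
  by apply/AB/gP; rewrite (linB gl) gxy subrr.
move=> r /sub_addsmxP[[u v] /= ->]; have [y By <-] := SB _ (submxMl u S).
rewrite [v]mx11_scalar mul_scalar_mx; exists (v 0 0 *: x + y).
  by apply: sC.2 => //; exact: BC.
by rewrite gl addrC.
Qed.

End FiniteCodim.

(** * Eigenvectors modulo a subspace of finite codimension *)

Section Eigenvectors.
Context {K : numClosedFieldType} {L : banachLieType K}.
Variables (A : set L) (D : L -> L).
Hypotheses (sA : linear_subspace A) (fA : finite_codim A) (Dl : linear_map D).

(** The vector p(D) x. *)
Let ev (p : {poly K}) x := \sum_(i < size p) p`_i *: iter i D x.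

Let ev_bound (p : {poly K}) n x : (size p <= n)%N -> ev p x = \sum_(i < n) p`_i *: iter i D x.
Proof.
move=> pn; rewrite -(subnKC pn) big_split_ord /= [X in _ + X]big1 ?addr0 // => i _.
by rewrite nth_default ?scale0r // leq_addr.
Qed.

Let ev_XsubC (p : {poly K}) a x : ev (p * ('X - a%:P)) x = D (ev p x) - a *: ev p x.
Proof.
have le1 : (size (p * ('X - a%:P))%R <= (size p).+1)%N.
  by rewrite (leq_trans (size_polyMleq _ _)) // size_XsubC addnC.
rewrite (ev_bound _ le1) (lin_sum Dl) /=.
under eq_bigr do rewrite mulrBr coefB coefMX coefMC scalerBl.
rewrite big_split /= big_ord_recl /= scale0r add0r; congr (_ + _).
  by apply: eq_bigr => i _; rewrite (linZ Dl).
rewrite sumrN; congr (- _); rewrite big_ord_recr /= nth_default //.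
rewrite mul0r scale0r addr0 scaler_sumr; apply: eq_bigr => i _.
by rewrite scalerA mulrC.
Qed.

Let ev_stable (B : set L) (p : {poly K}) x :
  linear_subspace B -> (forall y, B y -> B (D y)) -> B x -> B (ev p x).
Proof.
by move=> sB DB Bx; apply: sub_sum => // i _; apply: subZ => //; exact: iter_fixed.
Qed.

(** The n + 1 vectors x, D x, ..., D^n x have dependent images under [g], which takes values in
    dimension n. *)
Let ev_kernel x : exists2 p : {poly K}, p != 0 & A (ev p x).
Proof.
have [n [g [gl gP]]] := finite_codim_kernel sA fA.
pose M := \matrix_(i < n.+1) g (iter i D x).
have /rowV0Pn[r rM r0] : kermx M != 0.
  rewrite kermx_eq0 /row_free neq_ltn; apply/orP; left.
  by rewrite ltnS rank_leq_col.
have rM0 : r *m M = 0 by apply/eqP; rewrite -sub_kermx.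
have sr : (size (rVpoly r) <= n.+1)%N by exact: size_poly.
exists (rVpoly r).
  by apply: contra r0 => /eqP h; rewrite -[r]rVpolyK h linear0.
rewrite (ev_bound _ sr); apply/gP; rewrite (lin_sum gl) -[RHS]rM0 mulmx_sum_row.
by apply: eq_bigr => i _; rewrite (linZ gl) rowK coef_rVpoly_ord.
Qed.

(** Take p with p(D) x in [A] and split off a root: p = q (X - a). If q(D) x is outside [A], it is
    the eigenvector, with eigenvalue a; otherwise q replaces p. *)
Lemma eigenvector_mod (B : set L) x :
  linear_subspace B -> (forall y, B y -> B (D y)) -> B x -> ~ A x ->
  exists y a, [/\ B y, ~ A y & A (D y - a *: y)].
Proof.
move=> sB DB Bx nAx; have [p p0 Ap] := ev_kernel x.
elim: (size p) {-2}p (leqnn (size p)) p0 Ap => [|n IH] {}p.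
  by rewrite size_poly_leq0 => ->.
(* A nonzero constant p would put [x] itself in [A]. *)
have [p1 _ p0 Ap|p1 pn p0 Ap] := leqP (size p) 1.
  case: nAx; have c0 : p`_0 != 0.
    by rewrite -[_`_0]/(p`_(1.-1)) (_ : 1%N = size p) // -?lead_coefE ?lead_coef_eq0 //;
      apply/esym/eqP; rewrite eqn_leq p1 size_poly_gt0.
  have := subZ sA (p`_0)^-1 Ap; rewrite (ev_bound _ p1) big_ord1 /=.
  by rewrite scalerA mulVf // scale1r.
have [a /factor_theorem[q pq]] := closed_rootP p (negbT (gtn_eqF p1)).
have q0 : q != 0 by apply: contra p0 => /eqP q0; rewrite pq q0 mul0r.
have qn : (size q <= n)%N.
  move: pn; rewrite pq size_Mmonic ?monicXsubC // size_XsubC addn2 /=.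
  by rewrite ltnS.
have [Aq|nAq] := pselect (A (ev q x)); first exact: (IH q).
exists (ev q x), a; split => //; first exact: ev_stable.
by rewrite -ev_XsubC -pq.
Qed.

End Eigenvectors.

(** [B] is the union of the preimages of [A] under the powers of [D]. An eigenvector y modulo [B]
    would give an eigenvector D^k y modulo [A]; its eigenvalue is 0, so y would lie in [B]. Finitely
    many spanning vectors make the exponent uniform. *)
Lemma nilpotent_mod {K : numClosedFieldType} {L : banachLieType K} (A : set L)
  (D : L -> L) : linear_subspace A -> finite_codim A -> linear_map D ->
  (forall x, A x -> A (D x)) ->
  (forall y a, ~ A y -> A (D y - a *: y) -> a = 0) ->
  exists m, forall x, A (iter m D x).
Proof.
move=> sA fA Dl DA D0; pose B := [set x | exists k, A (iter k D x)].
have up k m x : (k <= m)%N -> A (iter k D x) -> A (iter m D x).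
  by move=> km; rewrite -(subnK km) iterD; exact: iter_fixed.
have sB : linear_subspace B.
  split; first by exists 0%N; exact: sub0.
  move=> a x y [k Ak] [m Am]; exists (maxn k m).
  rewrite (lin_iter _ Dl); apply: sA.2.
    by apply: up Ak; rewrite leq_maxl.
  by apply: up Am; rewrite leq_maxr.
have DB x : B x -> B (D x).
  by move=> [k Ak]; exists k; rewrite -iterSr iterS; exact: DA.
have BT x : B x.
  apply: contrapT => nBx.
  have AB : A `<=` B by move=> y Ay; exists 0%N.
  have [y [a [_ nBy [k]]]] :=
    eigenvector_mod sB (finite_codim_sub AB fA) Dl subspaceT (fun _ _ => I) I nBx.
  rewrite (linB (lin_iter k Dl)) (linZ (lin_iter k Dl)) -iterSr iterS => Ak.
  have nAk : ~ A (iter k D y) by move=> h; apply: nBy; exists k.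
  have a0 := D0 _ _ nAk Ak; apply: nBy; exists k.+1.
  by move: Ak; rewrite a0 scale0r subr0 iterS.
have [n [v vP]] := fA.
pose k i := sval (cid (BT (v i))).
exists (\max_i k i)%N => x; have [c Ac] := vP x.
rewrite -[x](subrK (\sum_(i < n) c i *: v i)) (linD (lin_iter _ Dl)).
apply: subD => //; first exact: iter_fixed.
rewrite (lin_sum (lin_iter _ Dl)); apply: sub_sum => // i _.
rewrite (linZ (lin_iter _ Dl)); apply: subZ => //.
by apply: up (svalP (cid (BT (v i)))); exact: leq_bigmax.
Qed.

(** * Limits of geometric Cauchy sequences and closed subspaces *)

(** The Archimedean property in the form used by geometric estimates, common to [R] and [R[i]]. *)
Definition geo_small (K : numFieldType) :=
  forall c e : K, 0 <= c -> 0 < e -> exists n : nat, forall m, (n <= m)%N ->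
    c * 2^-1 ^+ m < e.

Lemma geo_small_real (R : realType) : geo_small R.
Proof.
move=> c e c0 e0; exists (Num.bound (c / e)) => m nm.
rewrite exprVn -ltr_pdivlMr ?exprn_gt0 ?invr_gt0 ?exprn_gt0 // invrK mulrC.
rewrite -ltr_pdivrMr //; apply: lt_le_trans (archi_boundP _) _.
  by rewrite divr_ge0 // ltW.
rewrite -natrX ler_nat; apply: leq_trans nm _; exact/ltnW/ltn_expl.
Qed.

Lemma geo_small_complex (R : realType) : geo_small R[i].
Proof.
move=> c e c0 e0.
have [r cr] := complex_realP _ (ger0_real c0).
have [s es] := complex_realP _ (gtr0_real e0).
move: c0 e0; rewrite cr es ler0c ltcR => r0 s0.
have [n nP] := geo_small_real r0 s0; exists n => m /nP.
by rewrite -ltcR rmorphM rmorphXn fmorphV rmorph_nat.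
Qed.

Section Geometric.
Context {K : numFieldType} (Ksmall : geo_small K).

Lemma le_geo_small (a b c : K) : a \is Num.real -> b \is Num.real -> 0 <= c ->
  (forall n, a <= b + c * 2^-1 ^+ n) -> a <= b.
Proof.
move=> ar br c0 ab; have [//|ba] := real_leP ar br.
have /Ksmall-/(_ _ c0)[n /(_ n (leqnn n)) h] : 0 < a - b by rewrite subr_gt0.
by move: h; rewrite ltrBrDl => /(le_lt_trans (ab n)); rewrite ltxx.
Qed.

Lemma le0_geo_small (a c : K) : 0 <= a -> 0 <= c ->
  (forall n, a <= c * 2^-1 ^+ n) -> a = 0.
Proof.
move=> a0 c0 h; apply/eqP; rewrite eq_le a0 andbT.
by apply: (@le_geo_small _ _ c) => //; [exact: ger0_real|move=> n; rewrite add0r].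
Qed.

Lemma geo_cvg (V : completeNormedModType K) (u : nat -> V) (C : K) : 0 <= C ->
  (forall n m, (n <= m)%N -> `|u m - u n| <= C * 2^-1 ^+ n) ->
  exists l, forall n, `|l - u n| <= C * 2^-1 ^+ n.
Proof.
move=> C0 uC.
have /cauchy_cvg/cvg_ex[l ul] : cauchy (u @ \oo).
  apply/cauchy_ballP => e e0; have [N NP] := Ksmall C0 (divr_gt0 e0 (ltr0Sn _ 1)).
  exists ([set u n | n in [set n | (N <= n)%N]], [set u n | n in [set n | (N <= n)%N]]).
    by split; exists N => // n /= Nn; exists n.
  move=> [_ _] /= [[n Nn <-] [m Nm <-]]; rewrite -ball_normE /ball_ /=.
  rewrite (splitr e) -(subrK (u N) (u n)) -addrA.
  apply: le_lt_trans (ler_normD _ _) _; apply: ltrD.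
    exact: le_lt_trans (uC _ _ Nn) (NP _ (leqnn N)).
  by rewrite distrC; exact: le_lt_trans (uC _ _ Nm) (NP _ (leqnn N)).
exists l => n; apply: (@le_geo_small _ _ 1) => // [||k]; [exact: normr_real| |].
  by apply: ger0_real; rewrite mulr_ge0 ?exprn_ge0 ?invr_ge0.
have /cvgrPdist_lt /(_ (1 * 2^-1 ^+ k)) : u @ \oo --> l by [].
rewrite mul1r exprn_gt0 ?invr_gt0 // => /(_ isT)[N _ NP].
have := NP _ (leq_maxl N n) => /= lu.
rewrite -(subrK (u (maxn N n)) l) -addrA; apply: le_trans (ler_normD _ _) _.
by rewrite [leRHS]addrC; apply: lerD; [exact: ltW|exact: uC (leq_maxr _ _)].
Qed.

End Geometric.

Section ClosedSets.
Context {K : numFieldType} {V : normedModType K}.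

Lemma closed_approx (A : set V) x :
  closed A -> (forall e : K, 0 < e -> exists2 y, A y & `|x - y| < e) -> A x.
Proof.
move=> cA xA; apply: cA => U /nbhs_ballP[e /= e0 eU].
have [y Ay xy] := xA e e0; exists y; split => //; apply: eU.
by rewrite -ball_normE.
Qed.

Lemma approx_closed (A : set V) :
  (forall x, (forall e : K, 0 < e -> exists2 y, A y & `|x - y| < e) -> A x) ->
  closed A.
Proof.
move=> h x clx; apply: h => e e0.
have [y [Ay xy]] := clx _ (nbhsx_ballx x e e0).
by exists y => //; move: xy; rewrite -ball_normE.
Qed.

Lemma closed_far (A : set V) x : closed A -> ~ A x ->
  exists2 e : K, 0 < e & forall y, A y -> e <= `|x - y|.
Proof.
move=> cA nAx; apply: contrapT => h; apply: nAx; apply: closed_approx => // e e0.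
apply: contrapT => h1; apply: h; exists e => // y Ay.
rewrite real_leNgt ?normr_real ?gtr0_real //; apply/negP => xy.
by apply: h1; exists y.
Qed.

End ClosedSets.

Lemma closed_preim (K : numFieldType) (U V : normedModType K) (f : U -> V)
  (A : set V) c : 0 <= c ->
  (forall x y, `|f x - f y| <= c * `|x - y|) -> closed A ->
  closed [set x | A (f x)].
Proof.
move=> c0 fc cA; apply: approx_closed => x xA /=; apply: closed_approx => // e e0.
have c1 : 0 < c + 1 by rewrite ltr_wpDl.
have [y Ay xy] := xA _ (divr_gt0 e0 c1); exists (f y) => //.
apply: le_lt_trans (fc x y) _; move: xy; rewrite ltr_pdivlMr // mulrC.
by apply: le_lt_trans; rewrite ler_wpM2r // lerDl.
Qed.

(** Real and imaginary parts converge separately in [R]; adding the two errors gives the factor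
    2. *)
Lemma complex_geo_cvg (R : realType) (u : nat -> R[i]) (C : R[i]) : 0 <= C ->
  (forall n m, (n <= m)%N -> `|u m - u n| <= C * 2^-1 ^+ n) ->
  exists l, forall n, `|l - u n| <= C *+ 2 * 2^-1 ^+ n.
Proof.
move=> C0; have [c Cc] := complex_realP _ (ger0_real C0).
move: C0; rewrite Cc ler0c => c0 uC.
have geoE n : c%:C * 2^-1 ^+ n = (c * 2^-1 ^+ n)%:C :> R[i].
  by rewrite rmorphM rmorphXn fmorphV rmorph_nat.
pose normc (z : R[i]) : R := Num.sqrt (complex.Re z ^+ 2 + complex.Im z ^+ 2).
have ReIm (z : R[i]) : `|z| = (normc z)%:C by exact: normc_def.
have Rele (z : R[i]) : `|complex.Re z| <= normc z.
  by rewrite -sqrtr_sqr ler_wsqrtr // lerDl sqr_ge0.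
have Imle (z : R[i]) : `|complex.Im z| <= normc z.
  by rewrite -sqrtr_sqr ler_wsqrtr // lerDr sqr_ge0.
have uc n m : (n <= m)%N -> normc (u m - u n) <= c * 2^-1 ^+ n.
  by move=> /uC; rewrite geoE ReIm lecR.
have [a aP] : exists a : R, forall n, `|a - complex.Re (u n)| <= c * 2^-1 ^+ n.
  apply: (@geo_cvg _ (@geo_small_real R) R^o (fun n => complex.Re (u n))) => // n m nm.
  by apply: le_trans (uc _ _ nm); rewrite -raddfB; exact: Rele.
have [b bP] : exists b : R, forall n, `|b - complex.Im (u n)| <= c * 2^-1 ^+ n.
  apply: (@geo_cvg _ (@geo_small_real R) R^o (fun n => complex.Im (u n))) => // n m nm.
  by apply: le_trans (uc _ _ nm); rewrite -raddfB; exact: Imle.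
exists (Complex a b) => n.
have -> : Complex a b - u n =
    (a - complex.Re (u n))%:C + Complex 0 1 * (b - complex.Im (u n))%:C :> R[i].
  by case: (u n) => x y; simpc.
apply: le_trans (ler_normD _ _) _; rewrite mulrnAl mulr2n geoE; apply: lerD.
  by rewrite normc_def /= expr0n addr0 sqrtr_sqr lecR.
rewrite normrM; have -> : `|Complex 0 1| = 1 :> R[i].
  by rewrite normc_def /= expr0n add0r expr1n sqrtr1.
by rewrite mul1r normc_def /= expr0n addr0 sqrtr_sqr lecR.
Qed.

(** If [v] has distance at least d > 0 from [A], then |c| d <= |y + c v| for y in [A]. Hence the
    coefficients of [v] in approximations of x converge to some l, and x - l v is a limit of
    elements of [A]. *)
Lemma closed_addl (R : realType) (V : normedModType R[i]) (A : set V) v :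
  linear_subspace A -> closed A -> closed (addl A v).
Proof.
move=> sA cA; have [Av|nAv] := pselect (A v).
  rewrite (_ : addl A v = A) //; apply/seteqP; split; last exact: sub_addl.
  by move=> _ [c [y [Ay ->]]]; apply: (subD sA) => //; exact: (subZ sA).
have [d d0 dP] := closed_far cA nAv.
have far c y : A y -> `|c| * d <= `|y + c *: v|.
  move=> Ay; have [->|c0] := eqVneq c 0; first by rewrite normr0 mul0r normr_ge0.
  rewrite (_ : y + c *: v = c *: (v - (- c^-1 *: y))).
    by rewrite normrZ ler_wpM2l //; apply: dP; exact: (subZ sA).
  rewrite scalerBr scaleNr scalerN opprK scalerA mulfV // scale1r; exact: addrC.
apply: approx_closed => x xA.
have h n : exists cy : R[i] * V, A cy.2 /\ `|x - (cy.2 + cy.1 *: v)| < d * 2^-1 ^+ n.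
  have /xA[_ [c [y [Ay ->]]] xy] : 0 < d * 2^-1 ^+ n.
    by rewrite mulr_gt0 ?exprn_gt0 ?invr_gt0.
  by exists (c, y).
pose c n := (sval (cid (h n))).1; pose y n := (sval (cid (h n))).2.
have Ay n : A (y n) by case: (svalP (cid (h n))).
have xc n : `|x - (y n + c n *: v)| < d * 2^-1 ^+ n by case: (svalP (cid (h n))).
have mono n m : (n <= m)%N -> 2^-1 ^+ m <= 2^-1 ^+ n :> R[i].
  by move=> nm; rewrite ler_wiXn2l ?invr_ge0 // invf_le1 // ler1n.
have [l lc] : exists l : R[i], forall n, `|l - c n| <= 2%:R *+ 2 * 2^-1 ^+ n.
  apply: complex_geo_cvg => // n m nm; rewrite -(ler_pM2r d0).
  apply: le_trans (far _ _ (subB sA (Ay m) (Ay n))) _.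
  rewrite (_ : _ + _ = (x - (y n + c n *: v)) - (x - (y m + c m *: v))); last by lincomb R[i].
  apply: le_trans (ler_normB _ _) _.
  rewrite (_ : 2 * 2^-1 ^+ n * d = d * 2^-1 ^+ n + d * 2^-1 ^+ n); last by ring.
  apply: lerD; first exact: ltW.
  by apply: le_trans (ltW (xc m)) _; rewrite ler_pM2l // mono.
exists l, (x - l *: v); split; last by rewrite subrK.
apply: closed_approx cA _ => e e0.
have C0 : 0 <= d + 2%:R *+ 2 * `|v| by rewrite addr_ge0 ?mulr_ge0 ?(ltW d0) ?mulrn_wge0 ?normr_ge0 ?ler0n.
have [n nP] := geo_small_complex C0 e0; have ne := nP n (leqnn n).
exists (y n); first exact: Ay.
apply: le_lt_trans ne; rewrite mulrDl.
rewrite (_ : _ - _ = (x - (y n + c n *: v)) - (l - c n) *: v); last by lincomb R[i].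
apply: le_trans (ler_normB _ _) _; apply: lerD; first exact: ltW.
by rewrite normrZ mulrAC ler_wpM2r.
Qed.

(** A maximal closed subspace [C] between [A] and [B] contains every x in [B], because C + K x is
    again closed. *)
Lemma closed_sup (R : realType) (L : banachLieType R[i]) (A B : set L) :
  linear_subspace A -> closed A -> finite_codim A -> linear_subspace B -> A `<=` B -> closed B.
Proof.
move=> sA cA fA sB AB.
pose Phi := [set C : set L | [/\ linear_subspace C, A `<=` C, C `<=` B & closed C]].
have PhiS C : Phi C -> linear_subspace C /\ A `<=` C by case.
have PhiA : Phi A by split.
have [C [[sC AC CB cC] _ Cmax]] := max_subspace sA fA PhiS PhiA.
rewrite (_ : B = C) //; apply/seteqP; split => // x Bx.
rewrite -(Cmax (addl C x)); [exact: addl_self| |exact: sub_addl].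
split; [exact: subspace_addl|by apply: subset_trans AC _; exact: sub_addl| |exact: closed_addl].
by move=> _ [c [y [Cy ->]]]; apply: (subD sB); [exact: CB|exact: (subZ sB)].
Qed.

(** * Bilinearity, antisymmetry and the derivation form of the Jacobi identity *)

Section LieAlgebra.
Context {K : numFieldType} {L : banachLieType K}.
Implicit Types x y z : L.

Lemma lie_lin_l z : linear_map (fun x : L => lie x z).
Proof. by move=> a x y; rewrite lie_linearl. Qed.

Lemma lie_lin_r x : linear_map (fun z : L => lie x z).
Proof. by move=> a y z; rewrite lie_linearr. Qed.

Lemma lieDl x y z : lie (x + y) z = lie x z + lie y z.
Proof. exact: (linD (lie_lin_l z)). Qed.

Lemma lieDr x y z : lie x (y + z) = lie x y + lie x z.
Proof. exact: (linD (lie_lin_r x)). Qed.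

Lemma lieZl a x z : lie (a *: x) z = a *: lie x z.
Proof. exact: (linZ (lie_lin_l z)). Qed.

Lemma lieZr a x z : lie x (a *: z) = a *: lie x z.
Proof. exact: (linZ (lie_lin_r x)). Qed.

Lemma lieNl x z : lie (- x) z = - lie x z.
Proof. exact: (linN (lie_lin_l z)). Qed.

Lemma lieNr x z : lie x (- z) = - lie x z.
Proof. exact: (linN (lie_lin_r x)). Qed.

Lemma lieBl x y z : lie (x - y) z = lie x z - lie y z.
Proof. exact: (linB (lie_lin_l z)). Qed.

Lemma lieBr x y z : lie x (y - z) = lie x y - lie x z.
Proof. exact: (linB (lie_lin_r x)). Qed.

Lemma lieC x y : lie x y = - lie y x.
Proof.
have := lie_alt (x + y); rewrite lieDl !lieDr !lie_alt add0r addr0.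
by move/eqP; rewrite addr_eq0 => /eqP.
Qed.

Lemma lie_derivation x y z : lie x (lie y z) = lie (lie x y) z + lie y (lie x z).
Proof.
have := lie_jacobi x y z; rewrite (lieC z x) (lieC z (lie x y)) lieNr.
by move=> h; rewrite -[RHS]add0r -h; lincomb K.
Qed.

End LieAlgebra.

(** * Exponentials of bounded derivations *)

Definition lie_hom {K : numFieldType} {L1 L2 : banachLieType K} (f : L1 -> L2) :=
  linear_map f /\ forall x y, f (lie x y) = lie (f x) (f y).

Definition derivation {K : numFieldType} {L : banachLieType K} (D : L -> L) :=
  linear_map D /\ forall x y, D (lie x y) = lie (D x) y + lie x (D y).

Definition exp_term {K : numFieldType} {L : lmodType K} (D : L -> L) n (x : L) : L :=
  n`!%:R^-1 *: iter n D x.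

Definition exp_sum {K : numFieldType} {L : lmodType K} (D : L -> L) n (x : L) : L :=
  \sum_(i < n) exp_term D i x.

(** The limit of the exponential series, singled out by its rate of convergence. It exists and is
    unique when [D] is linear with bound at most 1/4; the default value 0 is then never taken. *)
Definition expD {K : numFieldType} {L : normedModType K} (D : L -> L) (x : L) : L :=
  xget 0 [set l | forall n, `|l - exp_sum D n x| <= 2 * `|x| * 2^-1 ^+ n].

Section Exponential.
Context {R : realType} {L : banachLieType R[i]}.
Local Notation K := R[i].

Section Bounded.
Variables (D : L -> L) (c : K).
Hypotheses (Dl : linear_map D) (c0 : 0 <= c) (c4 : c <= 4^-1)
  (Dc : forall x, `|D x| <= c * `|x|).
Implicit Types x y u : L.

Let ch : c <= 2^-1.
Proof. by apply: le_trans c4 _; rewrite lef_pV2 ?posrE ?ltr0n // ler_nat. Qed.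

Let cX n : 0 <= c ^+ n. Proof. exact: exprn_ge0. Qed.

Let cXh n : c ^+ n <= 2^-1 ^+ n.
Proof. by apply: lerXn2r; rewrite ?nnegrE ?invr_ge0 ?ler0n. Qed.

(** This estimate explains the bound 1/4 on [c]: in a product of two series, n errors of size c^n
    still decay like 2^-n, as n <= 2^n. *)
Let ncXh n : n%:R * c ^+ n <= 2^-1 ^+ n.
Proof.
apply: (@le_trans _ _ (2 ^+ n * 4^-1 ^+ n)).
  apply: ler_pM => //; rewrite ?ler0n //.
    by rewrite -natrX ler_nat; exact/ltnW/ltn_expl.
  by apply: lerXn2r; rewrite ?nnegrE ?invr_ge0 ?ler0n.
rewrite -exprMn (_ : 2 * 4^-1 = 2^-1 :> K) //.
by field.
Qed.

Lemma exp_term_lin n : linear_map (exp_term D n).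
Proof.
move=> a x y; rewrite /exp_term (lin_iter n Dl) scalerDr !scalerA.
by rewrite mulrC.
Qed.

Lemma exp_sum_lin n : linear_map (exp_sum D n).
Proof.
move=> a x y; rewrite /exp_sum scaler_sumr -big_split.
by apply: eq_bigr => i _; exact: exp_term_lin.
Qed.

Lemma exp_term_le n x : `|exp_term D n x| <= c ^+ n * `|x|.
Proof.
rewrite normrZ; apply: (@le_trans _ _ `|iter n D x|).
  rewrite ler_piMl // ger0_norm ?invr_ge0 ?ler0n // invf_le1 ?ltr0n ?fact_gt0 //.
  by rewrite ler1n fact_gt0.
elim: n => [|n IH]; first by rewrite mul1r.
by rewrite exprS -mulrA; apply: le_trans (Dc _) _; exact: ler_wpM2l.
Qed.

Lemma exp_sum_cauchy n m x : (n <= m)%N ->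
  `|exp_sum D m x - exp_sum D n x| <= 2 * c ^+ n * `|x|.
Proof.
move=> nm; apply: (@le_trans _ _ (2 * (c ^+ n - c ^+ m) * `|x|)); last first.
  by rewrite ler_wpM2r // ler_wpM2l // lerBlDr lerDl.
rewrite -(subnKC nm); elim: (m - n)%N => [|k IH].
  by rewrite addn0 !subrr normr0 mulr0 mul0r.
rewrite addnS {1}/exp_sum big_ord_recr /= -/(exp_sum _ _ _) addrAC.
apply: le_trans (ler_normD _ _) _; apply: le_trans (lerD IH (exp_term_le _ _)) _.
rewrite -mulrDl ler_wpM2r // exprS.
rewrite -subr_ge0 (_ : _ - _ = c ^+ (n + k) * (1 - 2 * c)); last by ring.
have two0 : (2 : K) != 0 by rewrite pnatr_eq0.
by rewrite mulr_ge0 // subr_ge0 -[leRHS](mulfV two0) ler_wpM2l.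
Qed.

Lemma expD_uniq x u (C : K) : 0 <= C ->
  (forall n, `|u - exp_sum D n x| <= C * 2^-1 ^+ n) -> expD D x = u.
Proof.
move=> C0 uC.
have [l lP] : exists l, forall n, `|l - exp_sum D n x| <= 2 * `|x| * 2^-1 ^+ n.
  apply: (geo_cvg (@geo_small_complex R)) => [|n m nm]; first by rewrite mulr_ge0.
  apply: le_trans (exp_sum_cauchy _ nm) _; rewrite mulrAC ler_wpM2l //.
  by rewrite mulr_ge0.
have eP n : `|expD D x - exp_sum D n x| <= 2 * `|x| * 2^-1 ^+ n.
  by rewrite /expD; case: xgetP => [_ -> //|/(_ l)[]].
apply/eqP; rewrite -subr_eq0 -normr_eq0; apply/eqP.
apply: (le0_geo_small (@geo_small_complex R) (c := 2 * `|x| + C)) => // [|n].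
  by rewrite addr_ge0 // mulr_ge0.
rewrite (_ : _ - u = (expD D x - exp_sum D n x) - (u - exp_sum D n x)); last by lincomb R[i].
by apply: le_trans (ler_normB _ _) _; rewrite mulrDl lerD.
Qed.

(** The definition of [expD] only gives the rate 2^-n. Comparison with the partial sums of order n +
    k, for all k, improves it to c^n, on which the second-order estimate [expD_near] depends. *)
Lemma expD_approx n x : `|expD D x - exp_sum D n x| <= 2 * c ^+ n * `|x|.
Proof.
have [l lP] : exists l, forall n, `|l - exp_sum D n x| <= 2 * `|x| * 2^-1 ^+ n.
  apply: (geo_cvg (@geo_small_complex R)) => [|{}n m nm]; first by rewrite mulr_ge0.
  apply: le_trans (exp_sum_cauchy _ nm) _; rewrite mulrAC ler_wpM2l //.
  by rewrite mulr_ge0.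
rewrite (expD_uniq _ lP) ?mulr_ge0 //.
apply: (le_geo_small (@geo_small_complex R) (c := 2 * `|x|)) => //.
- by apply: ger0_real; rewrite ?mulr_ge0.
- by apply: ger0_real; rewrite ?mulr_ge0.
- by rewrite mulr_ge0.
move=> k; rewrite (_ : l - _ = (l - exp_sum D (n + k) x) +
  (exp_sum D (n + k) x - exp_sum D n x)); last by lincomb R[i].
apply: le_trans (ler_normD _ _) _; rewrite addrC; apply: lerD.
  by apply: exp_sum_cauchy; rewrite leq_addr.
apply: le_trans (lP _) _; rewrite ler_wpM2l ?mulr_ge0 //.
by rewrite ler_wiXn2l ?leq_addl ?invr_ge0 // invf_le1 // ler1n.
Qed.

Lemma expD_lin : linear_map (expD D).
Proof.
move=> a x y; apply: (@expD_uniq _ _ (2 * (`|a| * `|x| + `|y|))).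
  by rewrite mulr_ge0 // addr_ge0 // mulr_ge0.
move=> n; rewrite exp_sum_lin.
rewrite (_ : _ - _ = a *: (expD D x - exp_sum D n x) + (expD D y - exp_sum D n y)); last by lincomb R[i].
apply: le_trans (ler_normD _ _) _; rewrite normrZ.
apply: le_trans (lerD (ler_wpM2l (normr_ge0 a) (expD_approx n x)) (expD_approx n y)) _.
rewrite [leLHS](_ : _ = 2 * (`|a| * `|x| + `|y|) * c ^+ n); last by ring.
by rewrite ler_wpM2l // mulr_ge0 // addr_ge0 // mulr_ge0.
Qed.

Lemma expD_le x : `|expD D x| <= 2 * `|x|.
Proof.
by have := expD_approx 0 x; rewrite /exp_sum big_ord0 subr0 expr0 mulr1.
Qed.

Lemma expD_near x : `|expD D x - x - D x| <= 2 * c ^+ 2 * `|x|.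
Proof.
have := expD_approx 2 x.
by rewrite /exp_sum big_ord_recl big_ord1 /exp_term /= invr1 !scale1r opprD addrA.
Qed.

(** In a Cauchy product, the triangle i + j < n + 1 is the triangle i + j < n together with the
    antidiagonal i + j = n. *)
Lemma exp_conv_sum (M : nmodType) (F : nat -> L -> M) y n :
  (forall i x z, F i (x + z) = F i x + F i z) ->
  \sum_(i < n.+1) F i (exp_sum D (n.+1 - i) y) =
  \sum_(i < n) F i (exp_sum D (n - i) y) + \sum_(i < n.+1) F i (exp_term D (n - i) y).
Proof.
move=> FD; rewrite big_ord_recr [X in _ = _ + X]big_ord_recr /= addrA -big_split /=.
congr (_ + _); last first.
  by rewrite subSnn subnn /exp_sum big_ord1.
apply: eq_bigr => i _; rewrite subSn; last exact: ltnW.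
by rewrite /exp_sum big_ord_recr FD.
Qed.

(** Convergence of a Cauchy product: [B i] are the terms of a series of operators with sum [Bl]. The
    tail of this series contributes 4 to the constant 6, the tails of the series for [expD D y]
    contribute 2. *)
Lemma exp_conv_lim (B : nat -> L -> L) (Bl : L -> L) (C : K) y n :
  0 <= C -> (forall i, linear_map (B i)) ->
  (forall i u, `|B i u| <= C * c ^+ i * `|u|) ->
  (forall m u, `|Bl u - \sum_(i < m) B i u| <= 2 * C * c ^+ m * `|u|) ->
  `|Bl (expD D y) - \sum_(i < n) B i (exp_sum D (n - i) y)| <=
    6 * C * `|y| * 2^-1 ^+ n.
Proof.
move=> C0 Bi BC BlC; set e := expD D y.
have -> : Bl e - \sum_(i < n) B i (exp_sum D (n - i) y) =
    (Bl e - \sum_(i < n) B i e) + \sum_(i < n) B i (e - exp_sum D (n - i) y).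
  rewrite [X in _ = _ + X](eq_bigr (fun i : 'I_n => B i e - B i (exp_sum D (n - i) y))); last first.
    by move=> i _; rewrite (linB (Bi _)).
  by rewrite sumrB addrA subrK.
apply: le_trans (ler_normD _ _) _.
rewrite (_ : 6 * C * `|y| * _ = 4 * C * `|y| * 2^-1 ^+ n + 2 * C * `|y| * 2^-1 ^+ n); last by ring.
apply: lerD.
  apply: le_trans (BlC _ _) _.
  apply: (@le_trans _ _ (2 * C * c ^+ n * (2 * `|y|))).
    by rewrite ler_wpM2l ?expD_le // !mulr_ge0.
  rewrite [leLHS](_ : _ = 4 * C * `|y| * c ^+ n); last by ring.
  by rewrite ler_wpM2l // !mulr_ge0.
apply: le_trans (ler_norm_sum _ _ _) _.
apply: (@le_trans _ _ (\sum_(i < n) 2 * C * `|y| * c ^+ n)).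
  apply: ler_sum => i _; apply: le_trans (BC _ _) _.
  apply: (@le_trans _ _ (C * c ^+ i * (2 * c ^+ (n - i) * `|y|))).
    by rewrite ler_wpM2l ?expD_approx // mulr_ge0.
  rewrite -[in leRHS](subnKC (ltnW (ltn_ord i))) exprD.
  by rewrite le_eqVlt; apply/orP; left; apply/eqP; ring.
rewrite sumr_const card_ord -[leLHS]mulr_natl mulrCA ler_wpM2l // !mulr_ge0 //.
Qed.

End Bounded.

Lemma exp_leibniz (D : L -> L) k x y : derivation D ->
  exp_term D k (lie x y) = \sum_(i < k.+1) lie (exp_term D i x) (exp_term D (k - i) y).
Proof.
move=> [Dl Dd].
have step m z : m.+1%:R *: exp_term D m.+1 z = D (exp_term D m z).
  rewrite /exp_term (linZ Dl) scalerA factS natrM invfM mulrA mulfV ?mul1r //.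
  by rewrite pnatr_eq0.
elim: k => [|k IH].
  by rewrite big_ord1 /exp_term /= invr1 !scale1r.
have k0 : k.+1%:R != 0 :> K by rewrite pnatr_eq0.
apply: (scalerI k0); rewrite step IH (lin_sum Dl).
under eq_bigr do rewrite Dd -!step (lieZl _.+1%:R) (lieZr _.+1%:R).
rewrite big_split /= scaler_sumr.
pose T i := lie (exp_term D i x) (exp_term D (k.+1 - i) y).
(* Differentiating the left factor produces the weight i, the right factor the weight k + 1 - i;
   together they make k + 1. *)
transitivity (\sum_(i < k.+2) i%:R *: T i + \sum_(i < k.+2) (k.+1 - i)%:R *: T i).
  congr (_ + _).
    rewrite [RHS]big_ord_recl scale0r add0r; apply: eq_bigr => i _.
    by rewrite /T /= /bump /= add1n subSS.
  rewrite [RHS]big_ord_recr /= subnn scale0r addr0; apply: eq_bigr => i _.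
  by rewrite /T /= subSn ?leq_ord.
rewrite -big_split; apply: eq_bigr => i _ /=.
by rewrite -scalerDl -natrD subnKC // -ltnS.
Qed.

(** By the binomial formula the sum is (1 - 1)^(k+1) D^(k+1) x / (k+1)!. *)
Lemma exp_inverse_term (D : L -> L) k x : linear_map D ->
  \sum_(i < k.+2) exp_term (fun z => - D z) i (exp_term D (k.+1 - i) x) = 0.
Proof.
move=> Dl.
have iterN n z : iter n (fun z => - D z) z = (-1) ^+ n *: iter n D z.
  elim: n => [|n IH]; first by rewrite scale1r.
  by rewrite iterS IH (linZ Dl) exprS -scalerA scaleN1r.
transitivity ((k.+1)`!%:R^-1 *: ((1 - 1) ^+ k.+1 *: iter k.+1 D x)); last first.
  by rewrite subrr expr0n /= scale0r scaler0.
rewrite exprBn scaler_suml scaler_sumr; apply: eq_bigr => i _.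
have ik : (i <= k.+1)%N by rewrite -ltnS.
rewrite /exp_term iterN (linZ (lin_iter i Dl)) -iterD subnKC //.
rewrite !scalerA !expr1n !mulr1; congr (_ *: _).
rewrite -(bin_fact ik) !natrM -mulr_natr.
have C0 : 'C(k.+1, i)%:R != 0 :> R[i] by rewrite pnatr_eq0 -lt0n bin_gt0.
by field; rewrite C0 !pnatr_eq0 -!lt0n !fact_gt0.
Qed.

End Exponential.

Definition bounded_by {K : numFieldType} {U V : normedModType K} (c : K) (f : U -> V) :=
  forall x, `|f x| <= c * `|x|.

Section ExponentialAutomorphism.
Context {R : realType} {L : banachLieType R[i]}.
Local Notation K := R[i].

Section Small.
Variables (D : L -> L) (c : K).
Hypotheses (Dd : derivation D) (c0 : 0 <= c) (c4 : c <= 4^-1) (Dc : bounded_by c D).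
Let Dl : linear_map D := Dd.1.

Lemma expD_lie : lie_hom (expD D).
Proof.
split=> [|x y]; first exact: (expD_lin Dl c0 c4 Dc).
have [t t0 tP] := @lie_bounded K L; have t0' := ltW t0.
apply: (expD_uniq c0 c4 Dc (C := 6 * (t * `|x|) * `|y|)).
  by rewrite !mulr_ge0.
move=> n; have -> : exp_sum D n (lie x y) =
    \sum_(i < n) lie (exp_term D i x) (exp_sum D (n - i) y).
  elim: n => [|n IH]; first by rewrite /exp_sum !big_ord0.
  rewrite (exp_conv_sum _ _ _ (F := fun i => lie (exp_term D i x))) => [|i u v]; last exact: lieDr.
  by rewrite -IH -exp_leibniz // /exp_sum big_ord_recr.
apply: (exp_conv_lim c0 c4 Dc (B := fun i => lie (exp_term D i x)) (Bl := lie (expD D x))).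
- by rewrite mulr_ge0.
- by move=> i; exact: lie_lin_r.
- move=> i u; apply: le_trans (tP _ _) _; rewrite ler_wpM2r //.
  by rewrite -!mulrA ler_wpM2l // mulrC; exact: exp_term_le.
- move=> m u; rewrite -(lin_sum (lie_lin_l u)) -lieBl.
  apply: le_trans (tP _ _) _; rewrite ler_wpM2r //.
  rewrite (_ : 2 * (t * `|x|) * c ^+ m = t * (2 * c ^+ m * `|x|)); last by ring.
  by rewrite ler_wpM2l //; exact: (expD_approx c0 c4 Dc).
Qed.

Lemma expD_stable (B : set L) x : linear_subspace B -> closed B ->
  (forall y, B y -> B (D y)) -> B x -> B (expD D x).
Proof.
move=> sB cB DB Bx; apply: (closed_approx cB) => e e0.
have x0 : 0 <= 2 * `|x| by rewrite mulr_ge0.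
have [n nP] := geo_small_complex x0 e0; exists (exp_sum D n x).
  apply: (sub_sum sB) => i _; apply: (subZ sB); exact: iter_fixed.
apply: le_lt_trans (nP n (leqnn n)).
apply: le_trans (expD_approx c0 c4 Dc _ _) _; rewrite mulrAC ler_wpM2l //.
apply: lerXn2r; rewrite ?nnegrE ?invr_ge0 ?ler0n //.
by apply: le_trans c4 _; rewrite lef_pV2 ?posrE ?ltr0n // ler_nat.
Qed.

End Small.

Lemma oppD_derivation (D : L -> L) : derivation D -> derivation (fun x => - D x).
Proof.
move=> [Dl Dd]; split=> [a x y|x y]; first by rewrite Dl; lincomb R[i].
by rewrite Dd lieNl lieNr opprD.
Qed.

Lemma oppD_bounded (D : L -> L) c : bounded_by c D -> bounded_by c (fun x => - D x).
Proof. by move=> Dc x; rewrite normrN. Qed.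

(** All antidiagonals of positive degree in the product of the two series vanish by
    [exp_inverse_term], so each triangular sum equals [x], while these sums converge to the
    composite. *)
Lemma expD_cancel (D : L -> L) c : derivation D -> 0 <= c -> c <= 4^-1 ->
  bounded_by c D -> cancel (expD D) (expD (fun x => - D x)).
Proof.
move=> Dd c0 c4 Dc x; have [D'd D'c] := (oppD_derivation Dd, oppD_bounded Dc).
set D' := fun z => - D z; have [Dl D'l] := (Dd.1, D'd.1).
apply/eqP; rewrite -subr_eq0 -normr_eq0; apply/eqP.
apply: (le0_geo_small (@geo_small_complex R) (c := 6 * `|x|)) => // [|n].
  by rewrite mulr_ge0.
have xE : x = \sum_(i < n.+1) exp_term D' i (exp_sum D (n.+1 - i) x).
  elim: n => [|n IH].
    by rewrite big_ord1 /exp_sum big_ord1 /exp_term /= invr1 !scale1r.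
  rewrite (exp_conv_sum _ _ _ (F := fun i => exp_term D' i)) => [|i u v].
    by rewrite exp_inverse_term // addr0.
  exact: (linD (exp_term_lin D'l i)).
rewrite {2}xE; have := exp_conv_lim c0 c4 Dc (B := fun i => exp_term D' i)
  (Bl := expD D') (C := 1) x n.+1 ler01.
rewrite mulr1; move/(_ (exp_term_lin D'l)) => h.
apply: (le_trans (h _ _)).
- by move=> i u; rewrite ?mul1r; exact: (exp_term_le _ D'c).
- by move=> m u; exact: (expD_approx c0 c4 D'c).
rewrite mulr1 ler_wpM2l ?mulr_ge0 //.
by rewrite ler_wiXn2l ?leqnSn ?invr_ge0 // invf_le1 // ler1n.
Qed.

(* [E] and [E'] behave like the automorphisms exp(D) and exp(-D) *)
Definition flow (D E E' : L -> L) :=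
  [/\ lie_hom E /\ lie_hom E', cancel E E' /\ cancel E' E,
      bounded_by 2 E /\ bounded_by 2 E' &
      forall (B : set L) x, linear_subspace B -> closed B ->
        (forall y, B y -> B (D y)) -> B x -> B (E x) /\ B (E' x)].

Lemma expD_flow (D : L -> L) c : derivation D -> 0 <= c -> c <= 4^-1 ->
  bounded_by c D -> flow D (expD D) (expD (fun x => - D x)).
Proof.
move=> Dd c0 c4 Dc; have [D'd D'c] := (oppD_derivation Dd, oppD_bounded Dc).
split; first by split; apply: expD_lie c0 c4 _.
- split; first exact: expD_cancel c0 c4 Dc.
  have DE : (fun z => - - D z) = D by apply/funext => z; rewrite opprK.
  have h : cancel (expD (fun z => - D z)) (expD (fun z => - - D z)).
    exact: expD_cancel D'd c0 c4 D'c.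
  by rewrite DE in h.
- by split=> x; [exact: (expD_le c0 c4 Dc x)|exact: (expD_le c0 c4 D'c x)].
move=> B x sB cB DB Bx; split.
  exact: (expD_stable c0 c4).
by apply: (expD_stable c0 c4) => // y By; apply: (subN sB); exact: DB.
Qed.

(* E is close to 1 + D, so that D is a limit of (E_s - 1) / s along s -> 0,
   where E_s is the flow of s D *)
Lemma derivation_invariant (A : set L) (D : L -> L) b :
  linear_subspace A -> closed A -> derivation D -> 0 <= b -> bounded_by b D ->
  (forall (s : K) E E', flow (fun x => s *: D x) E E' -> forall x, A x -> A (E x)) ->
  forall x, A x -> A (D x).
Proof.
move=> sA cA [Dl Dd] b0 Db AE x Ax; apply: (closed_approx cA) => e e0.
have C0 : 0 <= 2 * b ^+ 2 * `|x| by rewrite !mulr_ge0 ?exprn_ge0.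
have q0 : 0 < 4^-1 :> K by rewrite invr_gt0.
have [n nP] := geo_small_complex b0 q0.
have [m mP] := geo_small_complex C0 e0.
have {nP mP}[nP mP] := (nP _ (leq_maxl n m), mP _ (leq_maxr n m)).
(* The exponent n makes s D small enough for [expD_flow]; the exponent m brings the second-order
   error, divided by s, below e. *)
pose s : K := 2^-1 ^+ maxn n m.
have s0 : 0 < s by rewrite exprn_gt0 // invr_gt0.
pose Ds x := s *: D x.
have Dsl : linear_map Ds by move=> a u v; rewrite /Ds Dl; lincomb R[i].
have Dsd : derivation Ds.
  by split=> // u v; rewrite /Ds Dd lieZl lieZr scalerDr.
have Dsb : bounded_by (b * s) Ds.
  move=> u; rewrite normrZ (gtr0_norm s0) mulrAC [leRHS]mulrC.
  by apply: ler_wpM2l; [exact: ltW|exact: Db].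
have bs0 : 0 <= b * s by rewrite mulr_ge0 // ltW.
have bs4 : b * s <= 4^-1 by exact: ltW.
exists (s^-1 *: (expD Ds x - x)).
  apply: (subZ sA); apply: (subB sA) => //.
  exact: AE (expD_flow Dsd bs0 bs4 Dsb) _ Ax.
apply: le_lt_trans mP; rewrite -/s distrC.
rewrite (_ : _ - _ = s^-1 *: (expD Ds x - x - Ds x)); last first.
  by rewrite [RHS]scalerBr /Ds scalerA mulVf ?scale1r // gt_eqF.
rewrite normrZ ger0_norm ?invr_ge0 ?(ltW s0) // ler_pdivrMl //.
apply: le_trans (expD_near bs0 bs4 Dsb _) _.
by rewrite le_eqVlt; apply/orP; left; apply/eqP; ring.
Qed.

End ExponentialAutomorphism.

(** * Words and Engel's theorem *)

Definition word {K : numFieldType} {L : banachLieType K} (s : seq L) (z : L) : L :=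
  foldr lie z s.

Definition letters {T : eqType} (A : set T) (s : seq T) := forall y, y \in s -> A y.

Section Letters.
Context {T : eqType}.
Implicit Types (A : set T) (s : seq T).

Lemma letters_cons A y s : letters A (y :: s) <-> A y /\ letters A s.
Proof.
split=> [h|[Ay As] u]; last by rewrite inE => /predU1P[->|/As].
by split=> [|u us]; apply: h; rewrite inE ?eqxx // us orbT.
Qed.

Lemma letters_cat A s1 s2 : letters A (s1 ++ s2) <-> letters A s1 /\ letters A s2.
Proof.
split=> [h|[h1 h2] u]; last by rewrite mem_cat => /orP[/h1|/h2].
by split=> u us; apply: h; rewrite mem_cat us ?orbT.
Qed.

Lemma letters_nseq A n y : A y -> letters A (nseq n y).
Proof. by move=> Ay u; rewrite mem_nseq => /andP[_ /eqP ->]. Qed.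

Lemma letters_nil A : letters A [::]. Proof. by []. Qed.

Lemma letters_sub A (B : set T) s : A `<=` B -> letters A s -> letters B s.
Proof. by move=> AB As y /As; exact: AB. Qed.

End Letters.

Section Words.
Context {K : numFieldType} {L : banachLieType K}.
Implicit Types (s : seq L) (A B : set L).

Lemma word_cat s1 s2 (z : L) : word (s1 ++ s2) z = word s1 (word s2 z).
Proof. exact: foldr_cat. Qed.

Lemma word_lin s : linear_map (word s).
Proof. by elim: s => [|y s IH] a u v //=; rewrite IH lie_linearr. Qed.

Lemma word_nseq n (x z : L) : word (nseq n x) z = iter n (lie x) z.
Proof. by elim: n => //= n ->. Qed.

Lemma word_bounded s : exists2 c : K, 0 <= c & bounded_by c (word s).
Proof.
have [t t0 tP] := @lie_bounded K L.
elim: s => [|y s [c c0 cP]]; first by exists 1 => // z; rewrite mul1r.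
exists (t * `|y| * c); first by rewrite !mulr_ge0 // ltW.
move=> z /=; apply: le_trans (tP _ _) _; rewrite -[leRHS]mulrA ler_wpM2l //.
by rewrite mulr_ge0 // ltW.
Qed.

Lemma word_stable B s (z : L) : (forall y u, y \in s -> B u -> B (lie y u)) -> B z -> B (word s z).
Proof.
elim: s => //= y s IH yB Bz; apply: (yB); first by rewrite inE eqxx.
by apply: IH => // u v us; apply: yB; rewrite inE us orbT.
Qed.

(** The operator ad h is moved leftwards out of the word, one letter at a time; each commutator
    replaces a letter y by [h, y], which keeps the word in the class [T]. *)
Lemma word_derivation B (h : L) (T : seq L -> Prop) (z : L) s :
  linear_subspace B -> (forall u, B u -> B (lie h u)) ->
  (forall s1 y s2, T (s1 ++ y :: s2) -> T (s1 ++ lie h y :: s2)) ->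
  (forall s', T s' -> B (word s' z)) -> T s -> B (word s (lie h z)).
Proof.
move=> sB hB Th TB Ts.
suff H s2 s1 : T (s1 ++ s2) -> B (word s1 (lie h (word s2 z))) ->
    B (word (s1 ++ s2) (lie h z)).
  by apply: (H s [::]) => //=; exact/hB/TB.
elim: s2 s1 => [|y s2 IH] s1 Ts12 B12; first by rewrite cats0.
rewrite -cat_rcons; apply: IH; first by rewrite cat_rcons.
rewrite -cats1 word_cat /=.
have := TB _ (Th _ _ _ Ts12); rewrite word_cat /= => Bh.
have := subB sB B12 Bh; congr B; rewrite /= lie_derivation.
by rewrite (linD (word_lin s1)); lincomb K.
Qed.

Lemma finite_codim_preim (A : set L) (f : L -> L) : linear_subspace A ->
  finite_codim A -> linear_map f -> finite_codim [set x | A (f x)].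
Proof.
move=> sA fA fl; have [n [g [gl gP]]] := finite_codim_kernel sA fA.
apply: (@kernel_finite_codim _ _ _ _ (g \o f)) => [a x y|x /= /gP //].
by rewrite /= fl gl.
Qed.

Lemma first_true (Q : nat -> Prop) n : ~ Q 0%N -> Q n -> exists k, Q k.+1 /\ ~ Q k.
Proof.
move=> nQ0; elim: n => // n IH QSn.
by have [/IH//|nQn] := pselect (Q n); exists n.
Qed.

End Words.

(** * Engel's theorem for the action of M on L / P *)

Section Engel.
Context {K : numFieldType} {L : banachLieType K}.
Variables M P : set L.
Hypotheses (sM : linear_subspace M) (fM : finite_codim M)
  (MM : forall x y, M x -> M y -> M (lie x y))
  (sP : linear_subspace P) (MP : M `<=` P)
  (MPP : forall x y, M x -> P y -> P (lie x y))
  (Mnil : forall x, M x -> exists r, forall y, P (iter r (lie x) y)).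

Let fP : finite_codim P := finite_codim_sub MP fM.

(** For H inside [M], an ascending filtration starting at [P]; it reaches L at step N when
    [nilp H N] holds. *)
Let level (H : set L) k : set L :=
  [set y | forall s, size s = k -> letters H s -> P (word s y)].

Let nilp (H : set L) N := forall s y, size s = N -> letters H s -> P (word s y).

(** The kernel of the action of [M] on L / P. *)
Let Ker := [set x | M x /\ forall y, P (lie x y)].

Let sKer : linear_subspace Ker.
Proof.
split; first by split; [exact: sub0|move=> y; rewrite (lin0 (lie_lin_l y)); exact: sub0].
move=> a x y [Mx Px] [My Py]; split; first exact: sM.2.
by move=> z; rewrite lie_linearl; apply: sP.2.
Qed.

Let fKer : finite_codim Ker.
Proof.
have [n [v vP]] := fP.
pose A (i : 'I_n) := [set x : L | P (lie x (v i))].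
have sA i : linear_subspace (A i) by exact: (subspace_preim (lie_lin_l _) sP).
have fA i : finite_codim (A i) by exact: (finite_codim_preim sP fP (lie_lin_l _)).
have sI : linear_subspace [set x | forall i, A i x].
  split=> [i|a x y Ax Ay i]; first exact: (sub0 (sA i)).
  exact: (sA i).2.
apply: finite_codim_sub (finite_codimI sM sI fM (finite_codim_bigI sA fA)).
move=> x [Mx Ax]; split => // y; have [c Pc] := vP y.
rewrite -[y](subrK (\sum_(i < n) c i *: v i)) lieDr (lin_sum (lie_lin_r x)).
apply: (subD sP); first exact: MPP.
by apply: (sub_sum sP) => i _; rewrite lieZr; apply: (subZ sP); exact: Ax.
Qed.

Section Subalgebra.
Variables (H : set L) (N : nat).
Hypotheses (sH : linear_subspace H) (HM : H `<=` M)
  (HH : forall x y, H x -> H y -> H (lie x y)) (HN : nilp H N).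

Let P_word s y : letters H s -> P y -> P (word s y).
Proof. by move=> Hs; apply: word_stable => u v us; apply: MPP; exact/HM/Hs. Qed.

Let nilp_ge s y : (N <= size s)%N -> letters H s -> P (word s y).
Proof.
move=> Ns; rewrite -(cat_take_drop (size s - N) s) => /letters_cat[Ht Hd].
rewrite word_cat; apply: P_word => //; apply: HN => //.
by rewrite size_drop subKn.
Qed.

Lemma level_sub k : linear_subspace (level H k).
Proof.
split=> [s _ _|a x y lx ly s sk Hs]; first by rewrite (lin0 (word_lin s)); exact: sub0.
by rewrite word_lin; apply: sP.2; [exact: lx|exact: ly].
Qed.

Let level_down k b y : H b -> level H k.+1 y -> level H k (lie b y).
Proof.
move=> Hb ly s sk Hs; have := ly (rcons s b); rewrite size_rcons sk => /(_ erefl).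
rewrite -cats1 word_cat; apply; apply/letters_cat; split => //.
exact/letters_cons.
Qed.

Let level_up k y : level H k y -> level H k.+1 y.
Proof.
move=> ly [//|b s] /= [sk] /letters_cons[Hb Hs].
by apply: MPP; [exact: HM|exact: ly].
Qed.

Let level_up0 k y : P y -> level H k y.
Proof. by move=> Py s _ Hs; exact: P_word. Qed.

(** As an operator on L / P, the iterated bracket expands into products with letters on both sides
    of [a]. Out of 2 N letters at least N stand on one side, and such a product vanishes. In [F],
    the word [s] collects the letters on the left, and the level of [y] drops with each letter on
    the right. *)
Let Ker_word t a : M a -> letters H t -> size t = (N + N)%N -> Ker (word t a).
Proof.
move=> Ma Ht tN; split.
  by apply: word_stable Ma => y u yt; apply: MM; exact/HM/Ht.
suff F t' s j y : letters H t' -> letters H s -> level H j y ->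
    (N + j <= size t' + size s)%N -> P (word s (lie (word t' a) y)).
  move=> y; apply: (F t [::] N) => //; first by move=> s; exact: HN.
  by rewrite tN addn0.
elim: t' s j y => [|b t' IH] s j y /= Ht' Hs ly le.
  by apply: nilp_ge => //; apply: leq_trans le; exact: leq_addr.
have [Hb {}Ht'] := (letters_cons _ _ _).1 Ht'.
have Mw : M (word t' a).
  by apply: word_stable Ma => u v ut; apply: MM; exact/HM/Ht'.
have -> : lie (lie b (word t' a)) y =
    lie b (lie (word t' a) y) - lie (word t' a) (lie b y).
  by rewrite [lie b (lie _ _)]lie_derivation; lincomb K.
rewrite (linB (word_lin s)); apply: (subB sP).
  rewrite -[word s _]/(word s (word [:: b] _)) -word_cat; apply: (IH _ j) => //.
    by apply/letters_cat; split=> //; exact/letters_cons.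
  by rewrite size_cat /= addn1 addnS -addSn.
case: j ly le => [|j] ly le.
  apply: P_word => //; apply: (MPP Mw); apply: MPP; first exact: HM.
  by have := ly [::] erefl; apply.
apply: (IH _ j) => //; first exact: level_down.
by move: le; rewrite addnS addSn ltnS.
Qed.

(** The classical extension step: an element c outside [H] with [H, c] inside [H] is adjoined. As c
    preserves the levels and acts nilpotently, r letters of H + K c lower the level by one when c^r
    = 0 on L / P, and N r letters suffice. *)
Lemma engel_extend a : M a -> ~ H a -> Ker `<=` H ->
  exists H' N', [/\ linear_subspace H', H `<=` H', H' `<=` M, ~ H' `<=` H &
    (forall x y, H' x -> H' y -> H' (lie x y)) /\ nilp H' N'].
Proof.
move=> Ma nHa KH.
(* The index k is chosen so that every word of k + 1 letters in [H] sends [a] into [H], but some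
   word of k letters does not; the latter yields c. *)
have [k [Qk nQk]] := @first_true (fun k => forall t, size t = k -> letters H t -> H (word t a)) (N + N)
  (fun h => nHa (h [::] erefl (@letters_nil _ _)))
  (fun t tN Ht => KH _ (Ker_word Ma Ht tN)).
have {nQk}[t [tk Ht nHt]] : exists t, [/\ size t = k, letters H t & ~ H (word t a)].
  apply: contrapT => h; apply: nQk => t tk Ht; apply: contrapT => nH.
  by apply: h; exists t.
set c := word t a in nHt.
have Mc : M c by apply: word_stable Ma => u v ut; apply: MM; exact/HM/Ht.
have Hc b : H b -> H (lie b c).
  by move=> Hb; apply: (Qk (b :: t)) => /=; [rewrite tk|exact/letters_cons].
have cH b : H b -> H (lie c b) by move=> /Hc Hbc; rewrite lieC; exact: (subN sH).
have [r rP] := Mnil Mc.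
have lc j y : level H j y -> level H j (lie c y).
  move=> ly s sj Hs.
  apply: (@word_derivation _ _ P c (fun s => size s = j /\ letters H s)) => //.
  - by move=> u; exact: MPP.
  - move=> s1 u s2 []; rewrite !size_cat /= => <- /letters_cat[Hs1 /letters_cons[Hu Hs2]].
    by split=> //; apply/letters_cat; split=> //; apply/letters_cons; split=> //; exact: cH.
  - by move=> s' [s'j Hs']; exact: ly.
have lH' j u y : addl H c u -> level H j y -> level H j (lie u y).
  move=> [d [b [Hb ->]]] ly; rewrite lieDl lieZl; apply: (subD (level_sub j)).
    move=> s sj Hs; case: j ly sj => [|j] ly sj.
      apply: P_word => //; apply: MPP; first exact: HM.
      by have := ly [::] erefl; apply.
    exact: (level_up (level_down Hb ly)).
  by apply: (subZ (level_sub j)); exact: lc.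
(* Modulo level j, every word in H + K c acts on level j + 1 as a multiple of a power of c. *)
have low j s y : letters (addl H c) s -> level H j.+1 y ->
    exists d, level H j (word s y - d *: iter (size s) (lie c) y).
  move=> + ly; elim: s => [_|u s IH /letters_cons[H'u H's]] /=.
    by exists 1; rewrite scale1r subrr; exact: sub0 (level_sub j).
  have [d ld] := IH H's; have lw : level H j.+1 (word s y).
    by apply: word_stable ly => v w vs; apply: lH'; exact: H's.
  have [e [b [Hb ->]]] := H'u; exists (e * d).
  have := subD (level_sub j) (level_down Hb lw) (subZ (level_sub j) e (lc _ _ ld)).
  congr (level H j _); rewrite lieDl lieZl lieBr lieZr; lincomb K.
exists (addl H c), (N * r)%N; split.
- exact: subspace_addl.
- exact: sub_addl.
- by move=> _ [d [b [Hb ->]]]; apply: (subD sM); [exact: HM|exact: (subZ sM)].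
- by move=> h; apply: nHt; apply: h; exact: addl_self.
split.
  move=> _ _ [d [b [Hb ->]]] [d' [b' [Hb' ->]]].
  exists 0, (lie b b' + d' *: lie b c + d *: lie c b'); split.
    apply: (subD sH); last by apply: (subZ sH); exact: cH.
    by apply: (subD sH); [exact: HH|apply: (subZ sH); exact: Hc].
  by rewrite !lieDl !lieDr !lieZl !lieZr lie_alt; lincomb K.
suff F j s y : size s = (j * r)%N -> letters (addl H c) s -> level H j y -> P (word s y).
  move=> s y sN Hs; apply: (F N s y sN Hs) => s' s'N Hs'; exact: HN.
elim: j s y => [|j IH] s y sz Hs ly.
  by have := ly [::] erefl; rewrite (size0nil sz) => /(_ (@letters_nil _ _)).
rewrite -(cat_take_drop (j * r) s) in Hs *; have [Hs1 Hd] := (letters_cat _ _ _).1 Hs.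
rewrite word_cat; apply: IH => //.
  by rewrite size_takel // sz leq_mul2r leqnSn orbT.
have [d ld] := low j _ y Hd ly.
have dr : size (drop (j * r) s) = r by rewrite size_drop sz mulSn addnK.
rewrite dr in ld; rewrite -[word _ _](subrK (d *: iter r (lie c) y)).
by apply: (subD (level_sub j)) => //; apply: (subZ (level_sub j)); exact/level_up0/rP.
Qed.

End Subalgebra.

(** A maximal subalgebra of [M] that contains [Ker] and acts nilpotently must be [M], by
    [engel_extend]; [Ker] itself starts the search. *)
Lemma engel : exists N, nilp M N.
Proof.
pose Phi := [set H | [/\ linear_subspace H, Ker `<=` H, H `<=` M,
  forall x y, H x -> H y -> H (lie x y) & exists N, nilp H N]].
have PhiS H : Phi H -> linear_subspace H /\ Ker `<=` H by case.
have PhiK : Phi Ker.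
  split=> //; first by move=> x [].
    move=> x y [Mx Px] [My Py]; split; first exact: MM.
    move=> z; have -> : lie (lie x y) z = lie x (lie y z) - lie y (lie x z).
      by rewrite [lie x (lie _ _)]lie_derivation; lincomb K.
    exact: (subB sP).
  by exists 1%N => -[//|x [|//]] y _ /letters_cons[[_ Px] _] /=.
have [H [[sH KH HM HH [N HN]] _ Hmax]] := max_subspace sKer fKer PhiS PhiK.
have [MH|/existsNP[a nMH]] := pselect (M `<=` H).
  by exists N => s y sN Ms; apply: HN => // u /Ms/MH.
have [Ma nHa] : M a /\ ~ H a.
  by split; [apply: contrapT => h; apply: nMH|move=> h; apply: nMH].
have [H' [N' [sH' HH' H'M nH'H [H'H' H'N]]]] := engel_extend sH HM HH HN Ma nHa KH.
case: nH'H; rewrite (Hmax H') //; split=> //; last by exists N'.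
exact: subset_trans HH'.
Qed.

(** Let k be such that level k is proper and level k + 1 is L. Then [M, L] lies in level k, and a
    nonzero coordinate of the quotient by level k is the functional. *)
Lemma engel_functional : P <> setT -> exists f : L -> K^o, [/\ linear_map f,
  exists x, f x <> 0, forall x, P x -> f x = 0 & forall x y, M x -> f (lie x y) = 0].
Proof.
move=> PT; have [N MN] := engel.
have lP : level M 0 = P.
  apply/seteqP; split=> y; first by move/(_ [::] erefl); apply.
  by move=> Py [].
have lT : level M N = setT by apply/seteqP; split=> // y _ s sN Ms; exact: MN.
have l0 : ~ level M 0 = setT by rewrite lP.
have [k [lk1 nlk]] := @first_true (fun k => level M k = setT) N l0 lT.
have sU := level_sub M k.
have PU : P `<=` level M k.
  by move=> y Py s _ Ms; apply: word_stable Py => u v /Ms Mu; exact: MPP.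
have [n [g [gl gP]]] := finite_codim_kernel sU (finite_codim_sub PU fP).
have [x0 gx0] : exists x, g x <> 0.
  apply: contrapT => h; apply: nlk; apply/seteqP; split=> // x _.
  by apply/gP; apply: contrapT => gx; apply: h; exists x.
have [j gj] : exists j, g x0 0 j != 0.
  apply: contrapT => h; apply: gx0; apply/rowP => j; rewrite mxE.
  by apply/eqP; apply: contraT => gj; case: h; exists j.
exists (fun x => g x 0 j); split.
- by move=> a x y; rewrite gl !mxE.
- by exists x0; apply/eqP.
- by move=> x /PU/gP ->; rewrite mxE.
move=> x y Mx; suff /gP -> : level M k (lie x y) by rewrite mxE.
move=> s sk Ms; have : level M k.+1 y by rewrite lk1.
move=> /(_ (rcons s x)); rewrite size_rcons sk -cats1 word_cat; apply => //.
by apply/letters_cat; split=> //; exact/letters_cons.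
Qed.

End Engel.

(** * The filtration of a subalgebra of finite codimension *)

Lemma bernoulli (K : numDomainType) (r : K) n : 1 <= r -> 1 + n%:R * (r - 1) <= r ^+ n.
Proof.
move=> r1; elim: n => [|n IH]; first by rewrite mul0r addr0.
have r0 : 0 <= r by exact: le_trans ler01 r1.
rewrite exprS; apply: le_trans (ler_wpM2l r0 IH).
rewrite -subr_ge0 (_ : _ - _ = n%:R * (r - 1) ^+ 2); last by rewrite -natr1; ring.
by rewrite mulr_ge0 // exprn_ge0 // subr_ge0.
Qed.

(** If a > b, then (a / b)^(2^k) exceeds 2^k (a / b - 1) by Bernoulli's inequality, so it cannot
    stay bounded. *)
Lemma growth_le (R : realType) (a b C d : R[i]) : 0 <= a -> 0 <= b -> 0 < d ->
  (forall m, a ^+ m * d <= C * b ^+ m) -> a <= b.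
Proof.
move=> a0 b0 d0 h; have [//|ba] := real_leP (ger0_real a0) (ger0_real b0).
have C0 : 0 <= C by have := h 0%N; rewrite !expr0 mul1r mulr1; exact/le_trans/ltW.
have b1 : 0 < b.
  rewrite lt_def b0 andbT; apply/eqP => bE.
  have := h 1%N; rewrite bE !expr1 mulr0 => /(lt_le_trans (mulr_gt0 (le_lt_trans b0 ba) d0)).
  by rewrite ltxx.
have r1 : 1 <= a / b by rewrite ler_pdivlMr // mul1r ltW.
have rd0 : 0 <= (a / b - 1) * d by rewrite mulr_ge0 ?(ltW d0) // subr_ge0.
have : (a / b - 1) * d = 0.
  apply: (le0_geo_small (@geo_small_complex R) (c := C)) => // k.
  rewrite exprVn ler_pdivlMr ?exprn_gt0 // mulrAC.
  have hk : (a / b) ^+ (2 ^ k) * d <= C.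
    have := h (2 ^ k)%N; rewrite -ler_pdivrMr ?exprn_gt0 //.
    by rewrite mulrAC -expr_div_n.
  apply: le_trans hk; rewrite ler_wpM2r ?(ltW d0) //.
  apply: le_trans (bernoulli _ r1).
  by rewrite -natrX mulrC lerDr.
move/eqP; rewrite mulf_eq0 (gt_eqF d0) orbF subr_eq0 => /eqP abE.
by move: ba; rewrite -(divfK (lt0r_neq0 b1) a) abE mul1r ltxx.
Qed.

(** The distance of [y] from [M] is positive, so |a|^m is at most a constant times the norm of any
    representative of a^m y modulo [M]. *)
Lemma growth_mod (R : realType) (L : banachLieType R[i]) (M : set L) (y : L)
    (a b C : R[i]) :
  linear_subspace M -> closed M -> ~ M y -> 0 <= b ->
  (forall m, exists2 w, M (w - a ^+ m *: y) & `|w| <= C * b ^+ m) -> `|a| <= b.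
Proof.
move=> sM cM nMy b0 h; have [d d0 dP] := closed_far cM nMy.
apply: (growth_le (normr_ge0 a) b0 d0 (C := C)) => m; have [w Mw wC] := h m.
apply: le_trans wC; rewrite -normrX.
have [->|am0] := eqVneq (a ^+ m) 0; first by rewrite normr0 mul0r.
have /dP : M (- (a ^+ m)^-1 *: (w - a ^+ m *: y)) by exact: subZ.
rewrite (_ : y - _ = (a ^+ m)^-1 *: w); last first.
  rewrite scalerBr scalerA mulNr mulVf // scaleNr; lincomb R[i].
by rewrite normrZ normfV ler_pdivlMl ?normr_gt0 // mulrC.
Qed.

Section Subalgebra.
Context {R : realType} {L : banachLieType R[i]}.
Local Notation K := R[i].
Variable M : set L.
Hypotheses (sM : linear_subspace M) (cM : closed M) (fM : finite_codim M)
  (MM : forall x y, M x -> M y -> M (lie x y)).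

(* The filtration M = F 1 >= F 2 >= ... of iterated stabilisers; its
   intersection is the largest ideal contained in M. *)
Definition filt n : set L := [set z | forall s, (size s < n)%N -> M (word s z)].

Lemma filt_sub n : linear_subspace (filt n).
Proof.
split=> [s _|a x y Fx Fy s sn]; first by rewrite (lin0 (word_lin s)); exact: sub0.
by rewrite word_lin; apply: sM.2; [exact: Fx|exact: Fy].
Qed.

Lemma filt_closed n : closed (filt n).
Proof.
rewrite (_ : filt n = \bigcap_(s in [set s : seq L | (size s < n)%N]) [set z | M (word s z)]) //.
apply: closed_bigI => s _; have [c c0 cP] := word_bounded s.
apply: (closed_preim c0 _ cM) => x y.
by rewrite -(linB (word_lin s)); exact: cP.
Qed.

Lemma filt_le n m : (n <= m)%N -> filt m `<=` filt n.
Proof. by move=> nm z Fz s sn; apply: Fz; exact: leq_trans nm. Qed.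

Lemma filt1 z : filt 1 z <-> M z.
Proof. by split=> [/(_ [::] isT)//|Mz] []. Qed.

Lemma filt_word s n z : filt (size s + n) z -> filt n (word s z).
Proof.
move=> Fz s' s'n; rewrite -word_cat; apply: Fz.
by rewrite size_cat addnC ltn_add2l.
Qed.

Lemma filt_lie y n z : filt n.+1 z -> filt n (lie y z).
Proof. exact: (@filt_word [:: y]). Qed.

Lemma filtS n z : filt n.+1 z <-> M z /\ forall y, filt n (lie y z).
Proof.
split=> [Fz|[Mz Fz]]; first by split=> [|y]; [exact/filt1/(filt_le _ Fz)|exact: filt_lie].
case/lastP => // s y; rewrite size_rcons ltnS -cats1 word_cat; exact: Fz.
Qed.

Lemma filt_stable h n z : M h -> filt n z -> filt n (lie h z).
Proof.
move=> Mh; elim: n z => // n IH z Fz; have [Mz Fyz] := (filtS _ _).1 Fz.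
apply/filtS; split=> [|y]; first exact: MM.
rewrite lie_derivation; apply: (subD (filt_sub n)); last exact: IH.
exact: filt_lie.
Qed.

(** The condition that [y, z] lies in step n needs testing only for y in a finite spanning set
    modulo [M]: elements of [M] preserve step n by [filt_stable]. *)
Lemma filt_codim n : finite_codim (filt n).
Proof.
elim: n => [|n IH]; first by apply: finite_codim_sub (finite_codimT).
have [k [v vP]] := fM.
pose A (i : 'I_k) := [set z : L | filt n (lie (v i) z)].
have sA i : linear_subspace (A i) by exact: (subspace_preim (lie_lin_r _) (filt_sub n)).
have fA i : finite_codim (A i).
  exact: (finite_codim_preim (filt_sub n) IH (lie_lin_r _)).
have sI : linear_subspace [set x | forall i, A i x].
  split=> [i|a x y Ax Ay i]; first exact: (sub0 (sA i)).
  exact: (sA i).2.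
have fI := finite_codimI sM (subspaceI (filt_sub n) sI) fM
  (finite_codimI (filt_sub n) sI IH (finite_codim_bigI sA fA)).
apply: finite_codim_sub fI => z [Mz [Fz Az]]; apply/filtS; split=> // y.
have [c Mc] := vP y; rewrite -[y](subrK (\sum_(i < k) c i *: v i)) lieDl.
apply: (subD (filt_sub n)); first exact: filt_stable.
rewrite (lin_sum (lie_lin_l z)); apply: (sub_sum (filt_sub n)) => i _.
by rewrite lieZl; apply: (subZ (filt_sub n)); exact: Az.
Qed.

(* Moving letters around costs a commutator, hence one step of the filtration. *)
Lemma word_move s1 a s2 z j : filt (size s1 + (size s2).+1 + j) z ->
  filt j.+1 (word (s1 ++ a :: s2) z - word (a :: s1 ++ s2) z).
Proof.
elim: s1 j => [|b s1 IH] j Fz /=; first by rewrite subrr; exact: sub0 (filt_sub _).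
have Fd : filt j.+2 (word (s1 ++ a :: s2) z - word (a :: s1 ++ s2) z).
  by apply: IH; move: Fz; rewrite /= !(addSn, addnS).
set w := word (s1 ++ s2) z in Fd *.
have Fw : filt j.+2 w.
  by apply: filt_word; move: Fz; rewrite /= size_cat !(addSn, addnS).
rewrite -/(word _ _) /= in Fd *.
have -> : lie b (word (s1 ++ a :: s2) z) - lie a (lie b w) =
    lie b (word (s1 ++ a :: s2) z - lie a w) + lie (lie b a) w.
  by rewrite lieBr [lie b (lie a w)]lie_derivation; lincomb R[i].
by apply: (subD (filt_sub _)); exact: filt_lie.
Qed.

Lemma word_perm s s' z j : perm_eq s s' -> filt (size s + j) z ->
  filt j.+1 (word s z - word s' z).
Proof.
elim: s s' j => [|a s IH] s' j.
  rewrite perm_sym => /perm_nilP -> _; rewrite subrr; exact: sub0 (filt_sub _).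
move=> ss' Fz; have as' : a \in s' by rewrite -(perm_mem ss') inE eqxx.
case/splitPr: _ / as' ss' => p q ss'.
have {}ss' : perm_eq s (p ++ q).
  by rewrite -(perm_cons a) (perm_trans ss') // -cat1s perm_catCA.
have Fd : filt j.+2 (word s z - word (p ++ q) z).
  by apply: IH => //; move: Fz; rewrite /= !(addSn, addnS).
rewrite (_ : _ - _ = lie a (word s z - word (p ++ q) z) -
   (word (p ++ a :: q) z - word (a :: p ++ q) z)); last first.
  by rewrite lieBr /=; lincomb R[i].
apply: (subB (filt_sub _)); first exact: filt_lie.
apply: word_move; move: Fz; rewrite /= (perm_size ss') size_cat.
by rewrite !(addSn, addnS).
Qed.

Lemma word_permM s s' z : perm_eq s s' -> filt (size s) z ->
  M (word s z) -> M (word s' z).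
Proof.
move=> ss' Fz Ms.
have /filt1 Md : filt 1 (word s z - word s' z).
  by apply: word_perm => //; rewrite addn0.
by have := subB sM Ms Md; congr M; lincomb R[i].
Qed.

(* any k elements of A have product 0 in the commutative algebra acting on the
   dual of the graded space of the filtration *)
Definition kills k (A : set L) :=
  forall s z, size s = k -> letters A s -> filt k z -> M (word s z).

Lemma kills_prefix k A s1 s2 z : kills k A -> (k <= size s1)%N -> letters A s1 ->
  filt (size s1 + size s2) z -> M (word (s1 ++ s2) z).
Proof.
move=> kA ks1; rewrite -(cat_take_drop k s1) => /letters_cat[A1 A2] Fz.
have sk : size (take k s1) = k by exact: size_takel.
rewrite -catA word_cat; apply: kA => //; apply: filt_word.
by move: Fz; rewrite !size_cat sk addnC addnA addnC -addnA [(size s2 + _)%N]addnC addnA.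
Qed.

Lemma killsM : kills 1 M.
Proof. by move=> [//|y [|//]] z _ /letters_cons[My _] /filt1 Mz; exact: MM. Qed.

Lemma kills_add k l A B : kills k A -> kills l B ->
  kills (k + l) [set x | exists a b, [/\ A a, B b & x = a + b]].
Proof.
move=> kA lB.
(* The letters of [sc] are split one by one into their components, collected in [sa] and [sb]; in
   the end there are k letters from [A] or l from [B]. *)
suff H sc sa sb z : letters A sa -> letters B sb ->
    letters [set x | exists a b, [/\ A a, B b & x = a + b]] sc ->
    (k + l <= size sa + (size sb + size sc))%N ->
    filt (size sa + (size sb + size sc)) z -> M (word (sa ++ sb ++ sc) z).
  move=> s z skl sAB Fz; apply: (H s [::] [::]) => //=.
    by rewrite skl.
  by rewrite skl.
elim: sc sa sb => [|c sc IH] sa sb Aa Bb Cc le Fz.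
  rewrite cats0; move: le Fz; rewrite addn0 => le Fz.
  have [ka|ka] := leqP k (size sa); first exact: kills_prefix kA ka Aa Fz.
  apply: (@word_permM (sb ++ sa)); first by rewrite perm_catC.
    by rewrite size_cat addnC.
  apply: (kills_prefix lB) => //; last by rewrite addnC.
  by have := leq_trans le (leq_add (ltnW ka) (leqnn _)); rewrite leq_add2l.
have [[a [b [Aa' Bb' ->]]] Cc'] := (letters_cons _ _ _).1 Cc.
rewrite catA word_cat /= lieDl (linD (word_lin _)).
rewrite -[lie a _]/(word (a :: sc) z) -[lie b _]/(word (b :: sc) z) -!word_cat.
rewrite -!catA; apply: (subD sM).
  apply: (@word_permM ((a :: sa) ++ sb ++ sc)).
  - by rewrite perm_sym catA (perm_catCA _ [:: a]) /= catA perm_refl.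
  - by move: Fz; rewrite !size_cat /= !(addSn, addnS).
  - apply: IH => //; first exact/letters_cons.
      by move: le; rewrite /= !(addSn, addnS).
    by move: Fz; rewrite /= !(addSn, addnS).
apply: (@word_permM (sa ++ (b :: sb) ++ sc)).
- by rewrite perm_cat2l perm_sym (perm_catCA _ [:: b]) /= perm_refl.
- by move: Fz; rewrite !size_cat /= !(addSn, addnS).
- apply: IH => //; first exact/letters_cons.
    by move: le; rewrite /= !(addSn, addnS).
  by move: Fz; rewrite /= !(addSn, addnS).
Qed.

Lemma word_line (x : L) s z : letters [set u | exists c : K, u = c *: x] s ->
  exists c : K, word s z = c *: word (nseq (size s) x) z.
Proof.
elim: s => [|u s IH /letters_cons[[c ->] /IH[d h]]] /=; first by exists 1; rewrite scale1r.
by exists (c * d); rewrite h lieZl lieZr scalerA.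
Qed.

Lemma kills_line k (x : L) : (forall z, filt k z -> M (word (nseq k x) z)) ->
  kills k [set u | exists c : K, u = c *: x].
Proof.
move=> kx s z sk /(word_line z)[c ->] Fz.
by apply: (subZ sM); rewrite sk; exact: kx.
Qed.

(** By [kills_add] a sum of two nilpotent subspaces is nilpotent, so a maximal one absorbs every
    line spanned by a nilpotent element. *)
Lemma max_kills : exists P, [/\ linear_subspace P, M `<=` P, exists k, kills k P &
  forall k x, (forall z, filt k z -> M (word (nseq k x) z)) -> P x].
Proof.
pose Phi := [set B | [/\ linear_subspace B, M `<=` B & exists k, kills k B]].
have PhiS B : Phi B -> linear_subspace B /\ M `<=` B by case.
have PhiM : Phi M by split=> //; exists 1%N; exact: killsM.
have [P [[sP MP [k kP]] _ Pmax]] := max_subspace sM fM PhiS PhiM.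
exists P; split=> //; first by exists k.
move=> l x /kills_line lx.
rewrite -(Pmax (addl P x)); [exact: addl_self| |exact: sub_addl].
split; [exact: subspace_addl|by apply: subset_trans MP _; exact: sub_addl|].
exists (k + l)%N => s z sk sA Fz; apply: (kills_add kP lx) => //.
apply: letters_sub sA => _ [c [y [Py ->]]].
by exists y, (c *: x); split=> //; exists c.
Qed.

End Subalgebra.

Lemma hom_word (K : numFieldType) (L1 L2 : banachLieType K) (E : L1 -> L2) s z :
  lie_hom E -> E (word s z) = word (map E s) (E z).
Proof. by move=> [_ El]; elim: s => //= y s <-; rewrite El. Qed.

Lemma lie_is_derivation (K : numFieldType) (L : banachLieType K) (h : L) :
  derivation (lie h).
Proof. by split=> [|x y]; [exact: lie_lin_r|exact: lie_derivation]. Qed.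

(** * Nilpotent elements and the action of M on them *)

Section NilElements.
Context {R : realType} {L : banachLieType R[i]}.
Local Notation K := R[i].
Variables (M P : set L) (kP : nat).
Hypotheses (sM : linear_subspace M) (cM : closed M) (fM : finite_codim M)
  (MM : forall x y, M x -> M y -> M (lie x y))
  (sP : linear_subspace P) (MP : M `<=` P) (kPP : kills M kP P)
  (Pmax : forall k x, (forall z, filt M k z -> M (word (nseq k x) z)) -> P x).

(** The flow of ad h consists of automorphisms preserving [M] and its filtration, so it maps
    nilpotent elements to nilpotent ones, that is, [P] into [P]. Differentiation gives the claim. *)
Lemma nil_stable h x : M h -> P x -> P (lie h x).
Proof.
move=> Mh; have [t t0 tP] := @lie_bounded K L.
have th0 : 0 <= t * `|h| by rewrite mulr_ge0 // ltW.
have cP : closed P by exact: closed_sup sM cM fM sP MP.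
apply: (derivation_invariant sP cP (lie_is_derivation h) th0 (tP h)).
move=> s E E' [[Ehom E'hom] [EK E'K] _ Est] p Pp; apply: (@Pmax kP) => z Fz.
have DM y : M y -> M (s *: lie h y) by move=> My; apply: (subZ sM); exact: MM.
have DF y : filt M kP y -> filt M kP (s *: lie h y).
  by move=> Fy; apply: (subZ (filt_sub sM _)); exact: filt_stable.
have [_ FE'z] := Est _ _ (filt_sub sM kP) (@filt_closed _ _ _ cM kP) DF Fz.
rewrite -(E'K z) -map_nseq -(hom_word _ _ Ehom); have [] // := Est M (word (nseq kP p) (E' z)) sM cM DM.
by apply: kPP => //; [exact: size_nseq|exact: letters_nseq].
Qed.

Section Eigenvector.
Variables (h x : L) (a : K).
Hypotheses (Mh : M h) (hx : P (lie h x - a *: x)).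
Let Px := addl P x.

Let Pxx : Px x := addl_self sP x.

Let Px_stable y : Px y -> Px (lie h y).
Proof.
move=> [c [p [Pp ->]]]; rewrite lieDr lieZr.
exists (c * a), (lie h p + c *: (lie h x - a *: x)); split; last by lincomb R[i].
by apply: (subD sP); [exact: nil_stable|exact: (subZ sP)].
Qed.

(** On these z, a product of n letters from P + K x depends, modulo [M], only on the x-components of
    the letters. *)
Let G n := [set z | filt M n z /\ forall p s, P p -> letters Px s ->
  (size s).+1 = n -> M (word (p :: s) z)].

Let sG n : linear_subspace (G n).
Proof.
split.
  split; first exact: sub0 (filt_sub sM n).
  by move=> p s _ _ _; rewrite (lin0 (word_lin (p :: s))); exact: sub0 sM.
move=> c y z [Fy Gy] [Fz Gz]; split; first exact: (filt_sub sM n).2.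
move=> p s Pp Ps sn; rewrite (word_lin (p :: s)).
by apply: sM.2; [exact: Gy|exact: Gz].
Qed.

Let G_stable n z : G n z -> G n (lie h z).
Proof.
move=> [Fz Gz]; split; first exact: filt_stable.
move=> p s Pp Ps sn.
apply: (@word_derivation _ _ M h (fun s' => exists q t,
  [/\ s' = q :: t, P q, letters Px t & (size t).+1 = n])) => //.
- by move=> u; exact: MM.
- move=> [|q s1] y s2 [q' [t [/= [<- <-] Pq Pt tn]]].
    by exists (lie h y), s2; split=> //; exact: nil_stable.
  exists q, (s1 ++ lie h y :: s2); split=> //; last first.
    by rewrite -tn !size_cat.
  have [Ps1 /letters_cons[Py Ps2]] := (letters_cat _ _ _).1 Pt.
  apply/letters_cat; split=> //; apply/letters_cons; split=> //.
  exact: Px_stable.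
- by move=> s' [q [t [-> Pq Pt tn]]]; exact: Gz.
by exists p, s.
Qed.

Let power_commute n z : G n z ->
  M (lie h (word (nseq n x) z) - word (nseq n x) (lie h z) - (n%:R * a) *: word (nseq n x) z).
Proof.
move=> [Fz Gz].
(* Here b counts the letters x that stand to the right of h. Each exchange of h with x adds a x and
   an element of [P], whose contribution vanishes on [G n]. *)
suff H b c : (c + b)%N = n -> M (word (nseq c x) (lie h (word (nseq b x) z)) -
    word (nseq n x) (lie h z) - (b%:R * a) *: word (nseq n x) z) by exact: (H n 0%N).
elim: b c => [|b IH] c cbn.
  move: cbn; rewrite addn0 => ->; rewrite mul0r scale0r subr0 subrr.
  exact: sub0 sM.
have := IH c.+1; rewrite addSnnS => /(_ cbn) IHc.
pose q := lie h x - a *: x.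
have : M (word (nseq c x ++ q :: nseq b x) z).
  have sz : size (q :: nseq c x ++ nseq b x) = n.
    by rewrite /= size_cat !size_nseq -cbn addnS.
  apply: (word_permM sM (s := q :: nseq c x ++ nseq b x)).
  - by rewrite perm_sym (perm_catCA _ [:: q]) perm_refl.
  - by rewrite sz.
  apply: Gz => //; apply/letters_cat; split; exact: letters_nseq.
move=> Mq; have := subD sM IHc Mq; congr M.
rewrite word_cat [word (q :: _) _]/= [word (nseq b.+1 x) z]/= lie_derivation.
rewrite (linD (word_lin _)) /q lieBl (linB (word_lin _)).
have -> : word (nseq c.+1 x) (lie h (word (nseq b x) z)) =
    word (nseq c x) (lie x (lie h (word (nseq b x) z))).
  by rewrite !word_nseq -iterSr.
have -> : word (nseq c x) (lie (a *: x) (word (nseq b x) z)) = a *: word (nseq n x) z.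
  rewrite lieZl (linZ (word_lin _)) -cbn nseqD word_cat.
  by [].
by rewrite -natr1; lincomb R[i].
Qed.

Hypothesis a0 : a != 0.

(** Otherwise, for each n, ad h has an eigenvector y = x^n z modulo [M] with z in [G n]. Its
    eigenvalue mu is at most t |h| in modulus; by [power_commute], so is mu - n a, read off from the
    powers of ad h on z through x^n. Then n |a| would be bounded. *)
Let G_nil : exists n, forall z, G n z -> M (word (nseq n x) z).
Proof.
apply: contrapT => nG; have [t t0 tP] := @lie_bounded K L.
have th0 : 0 <= t * `|h| by rewrite mulr_ge0 // ltW.
have hm m y : `|iter m (lie h) y| <= `|y| * (t * `|h|) ^+ m.
  elim: m => [|m IH]; first by rewrite mulr1.
  rewrite iterS exprS; apply: le_trans (tP _ _) _.
  by rewrite mulrCA; exact: ler_wpM2l.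
have key n : n%:R * `|a| <= 2 * (t * `|h|).
  have {nG}[z0 [Gz0 nMz0]] : exists z, G n z /\ ~ M (word (nseq n x) z).
    apply: contrapT => hn; apply: nG; exists n => z Gz.
    by apply: contrapT => nMz; apply: hn; exists z.
  pose B := [set y | exists z m, [/\ G n z, M m & y = word (nseq n x) z + m]].
  have sB : linear_subspace B.
    split.
      exists 0, 0; rewrite (lin0 (word_lin _)) addr0.
      by split=> //; [exact: sub0 (sG n)|exact: sub0 sM].
    move=> c _ _ [y [m [Gy Mm ->]]] [z [m' [Gz Mm' ->]]].
    exists (c *: y + z), (c *: m + m'); split; [exact: (sG n).2|exact: sM.2|].
    by rewrite word_lin; lincomb R[i].
  have hB y : B y -> B (lie h y).
    move=> [z [m [Gz Mm ->]]].
    exists (lie h z + (n%:R * a) *: z), (lie h m + (lie h (word (nseq n x) z) -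
      word (nseq n x) (lie h z) - (n%:R * a) *: word (nseq n x) z)); split.
    - apply: (subD (sG n)); first exact: G_stable.
      exact: (subZ (sG n)).
    - by apply: (subD sM); [exact: MM|exact: power_commute].
    - by rewrite lieDr (linD (word_lin _)) (linZ (word_lin _)); lincomb R[i].
  have Bz0 : B (word (nseq n x) z0).
    by exists z0, 0; rewrite addr0; split=> //; exact: sub0 sM.
  have [_ [mu [[z [m [Gz Mm ->]]] nMy My]]] :=
    eigenvector_mod sM fM (lie_lin_r h) sB hB Bz0 nMz0.
  pose y := word (nseq n x) z.
  have {}nMy : ~ M y by move=> My0; apply: nMy; exact: (subD sM).
  have {}My : M (lie h y - mu *: y).
    have := subD sM My (subB sM (subZ sM mu Mm) (MM Mh Mm)); congr M.
    by rewrite lieDr; lincomb R[i].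
  have mu_le : `|mu| <= t * `|h|.
    apply: (growth_mod sM cM nMy th0 (C := `|y|)) => k.
    exists (iter k (lie h) y) => //; elim: k => [|k IH] /=.
      by rewrite scale1r subrr; exact: sub0 sM.
    have := subD sM (MM Mh IH) (subZ sM (mu ^+ k) My); congr M.
    by rewrite lieBr lieZr exprSr; lincomb R[i].
  have nu_le : `|mu - n%:R * a| <= t * `|h|.
    have [c c0 cx] := word_bounded (nseq n x).
    apply: (growth_mod sM cM nMy th0 (C := c * `|z|)) => k.
    exists (word (nseq n x) (iter k (lie h) z)); last first.
      by apply: le_trans (cx _) _; rewrite -mulrA; exact: ler_wpM2l.
    have : G n (iter k (lie h) z) by apply: iter_fixed => // u; exact: G_stable.
    elim: k => [_|k IH Gk].
      by rewrite scale1r subrr; exact: sub0 sM.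
    have {Gk}Gk : G n (iter k (lie h) z) by apply: iter_fixed => // u; exact: G_stable.
    have Mk := IH Gk; set w := iter k (lie h) z in Gk Mk *; rewrite iterS -/w.
    set nu := mu - n%:R * a in Mk *.
    have := subB sM (subD sM (subB sM (MM Mh Mk) (subZ sM (n%:R * a) Mk)) (subZ sM (nu ^+ k) My))
      (power_commute Gk); congr M.
    by rewrite lieBr lieZr exprSr /nu -/y; lincomb R[i].
  rewrite -(normr_nat K n) -normrM.
  rewrite (_ : n%:R * a = mu - (mu - n%:R * a)); last by ring.
  apply: le_trans (ler_normB _ _) _.
  by rewrite mulr2n mulrDl mul1r; exact: lerD.
suff : `|a| = 0 by move/eqP; rewrite normr_eq0 (negbTE a0).
apply: (le0_geo_small (@geo_small_complex R) (c := 2 * (t * `|h|))) => //.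
  by rewrite mulr_ge0.
move=> k; rewrite exprVn ler_pdivlMr ?exprn_gt0 // mulrC -natrX.
exact: key.
Qed.

(** Words of [n0 + kP] letters are treated by the number of letters known to lie in [P]. With kP
    such letters they act as 0. With one fewer, the word [sp] of these letters sends z into some
    [G n] with n >= n0, on which the remaining letters act as a multiple of x^n, hence as 0.
    Descending to no letters in [P] shows that x is nilpotent. *)
Lemma eigenvector_nil : P x.
Proof.
have [n0 n0P] := G_nil.
have expand n z s k : (n0 <= n)%N -> G n z -> letters Px s -> (size s + k)%N = n ->
    M (word (s ++ nseq k x) z).
  move=> n0n Gz; elim: s k => [|y s IH] k /= Ps skn.
    move: skn; rewrite add0n => ->; rewrite -(subnKC n0n) nseqD word_cat.
    apply: n0P; split.
      by apply: filt_word; rewrite size_nseq subnK //; case: Gz.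
    move=> p s Pp Ps' sn0; rewrite -word_cat cat_cons; apply: Gz.2 => //.
      by apply/letters_cat; split=> //; exact: letters_nseq.
    by rewrite size_cat size_nseq -addSn sn0 subnKC.
  have [[c [p [Pp ->]]] {}Ps] := (letters_cons _ _ _).1 Ps.
  rewrite lieDl lieZl; apply: (subD sM).
    apply: (Gz.2 p (s ++ nseq k x)) => //.
      by apply/letters_cat; split=> //; exact: letters_nseq.
    by rewrite size_cat size_nseq -addSn.
  apply: (subZ sM); rewrite -[lie x _]/(word (x :: s ++ nseq k x) z).
  apply: (word_permM sM (s := s ++ nseq k.+1 x)).
  - by rewrite /= (perm_catCA s [:: x]) perm_refl.
  - by rewrite size_cat size_nseq addnS -addSn skn; case: Gz.
  by apply: IH => //; rewrite addnS -addSn.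
have St i sp s z : (i <= kP)%N -> letters P sp -> size sp = (kP - i)%N ->
    letters Px s -> (size s + size sp)%N = (n0 + kP)%N -> filt M (n0 + kP) z ->
    M (word (s ++ sp) z).
  elim: i sp s z => [|i IH] sp s z ik Psp szp Ps sz Fz.
    apply: (word_permM sM (s := sp ++ s)); first by rewrite perm_catC perm_refl.
      by rewrite size_cat addnC sz.
    apply: (kills_prefix kPP) => //; first by rewrite szp subn0.
    by rewrite addnC sz.
  have n0s : (n0 <= size s)%N.
    by rewrite -(leq_add2r (size sp)) sz leq_add2l szp leq_subr.
  rewrite word_cat -(cats0 s); apply: (expand (size s) _ s 0%N) => //.
  - split; first by apply: filt_word; rewrite addnC sz.
    move=> p t Pp Pt ts; rewrite -word_cat.
    have szt : (size t + size (p :: sp))%N = (n0 + kP)%N by rewrite addnS -addSn ts.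
    apply: (word_permM sM (s := t ++ p :: sp)).
    + by rewrite (perm_catCA t [:: p]) perm_refl.
    + by rewrite size_cat szt.
    apply: IH => //; first exact: ltnW.
      exact/letters_cons.
    by rewrite /= szp subnSK.
  - by rewrite addn0.
apply: (@Pmax (n0 + kP)) => z Fz.
rewrite -[nseq _ _]cats0; apply: (St kP) => //; first by rewrite subnn.
  exact: letters_nseq.
by rewrite size_nseq addn0.
Qed.

End Eigenvector.

Lemma nil_nilpotent h : M h -> exists r, forall y, P (iter r (lie h) y).
Proof.
move=> Mh; apply: (nilpotent_mod sP (finite_codim_sub MP fM) (lie_lin_r h)).
  by move=> x; exact: nil_stable.
move=> y a nPy Pya; apply/eqP; apply: contraT => a0; case: nPy.
exact: eigenvector_nil Mh Pya a0.
Qed.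

End NilElements.

(** * Maximal subalgebras *)

Section MaximalSubalgebra.
Context {R : realType} {L : banachLieType R[i]}.
Local Notation K := R[i].
Variable M : set L.
Hypotheses (cM : closed M) (aM : lie_subalgebra M) (fM : finite_codim M)
  (Mmax : forall B, closed B -> lie_subalgebra B -> M `<=` B -> B <> setT -> B = M).

Let sM : linear_subspace M. Proof. by case: aM. Qed.

Let MM : forall x y, M x -> M y -> M (lie x y). Proof. by case: aM. Qed.

Let linear_subalgebra (B : set L) : linear_subspace B ->
  (forall x y, B x -> B y -> B (lie x y)) -> lie_subalgebra B.
Proof. by move=> [B0 Bl] Bb. Qed.

Lemma invariant_functional (P : set L) k : linear_subspace P -> M `<=` P ->
  kills M k P ->
  (forall k x, (forall z, filt M k z -> M (word (nseq k x) z)) -> P x) ->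
  P <> setT -> exists f : L -> K^o, [/\ linear_map f,
    exists x, f x <> 0, forall x, M x -> f x = 0 &
    forall x y, M x -> f (lie x y) = 0].
Proof.
move=> sP MP kP Pmax PT.
have [x y|h|f [fl f0 fP fM0]] := engel_functional sM fM MM sP MP _ _ PT.
- by move=> Mx Py; exact: (nil_stable sM cM fM MM sP MP kP Pmax).
- by move=> Mh; exact: (nil_nilpotent sM cM fM MM sP MP kP Pmax).
by exists f; split=> // x /MP/fP.
Qed.

(* The stabiliser of f contains M. If it is M, then the form f([x, y]) is
   nondegenerate on L / M and f itself is f([v, y]) for an M-invariant v, so that
   L = M + K v and f(v) = f([v, v]) = 0. *)
Lemma invariant_functional_ideal (f : L -> K^o) : linear_map f ->
  (exists x, f x <> 0) -> (forall x, M x -> f x = 0) ->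
  (forall x y, M x -> f (lie x y) = 0) -> lie_ideal M.
Proof.
move=> fl [x0 fx0] fM0 fML.
have fLM x y : M y -> f (lie x y) = 0 by move=> My; rewrite lieC (linN fl) fML // oppr0.
pose S := [set x | forall y, f (lie x y) = 0].
have sS : linear_subspace S.
  split=> [y|a x y Sx Sy z]; first by rewrite (lin0 (lie_lin_l y)) (lin0 fl).
  by rewrite lie_linearl fl Sx Sy scaler0 addr0.
have SS x y : S x -> S y -> S (lie x y).
  move=> Sx Sy z; have -> : lie (lie x y) z = lie x (lie y z) - lie y (lie x z).
    by rewrite [lie x (lie _ _)]lie_derivation; lincomb R[i].
  by rewrite (linB fl) Sx Sy subrr.
have MS : M `<=` S by move=> x Mx y; exact: fML.
(* If f vanishes on [L, L], its kernel is a proper subalgebra, in fact an ideal, containing [M], so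
   it is [M]. *)
have [ST|nST] := pselect (S = setT).
  pose U := [set x | f x = 0].
  have sU : linear_subspace U.
    by split=> [|a x y Ux Uy]; rewrite /U /= ?(lin0 fl) // fl Ux Uy scaler0 addr0.
  have UL x y : U (lie x y) by change (f (lie x y) = 0); have Sx : S x by [rewrite ST]; exact: Sx.
  have MU : M `<=` U by [].
  have <- : U = M; last by case: sU => U0 Ul; split.
  apply: Mmax => //; first exact: closed_sup sM cM fM sU MU.
    exact: linear_subalgebra.
  by move=> UT; apply: fx0; change (U x0); rewrite UT.
have SM : S = M.
  by apply: Mmax => //; [exact: closed_sup sM cM fM sS MS|exact: linear_subalgebra].
have [n [v vP]] := fM.
(* The Gram matrix of f([x, y]) on a spanning family modulo [M]. The equation r B = phi is solvable
   because a vector of the cokernel of [B] gives some y in the stabiliser S = M, where f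
   vanishes. *)
pose B := \matrix_(i < n, j < n) (f (lie (v i) (v j)) : K).
pose phi := \row_(j < n) (f (v j) : K).
have /submxP[r phiE] : (phi <= B)%MS.
  rewrite submxE; apply/eqP/rowP => j; rewrite mxE [RHS]mxE.
  pose c i := cokermx B i j; pose y := \sum_(i < n) c i *: v i.
  have Sy : S y.
    move=> x; rewrite lieC (linN fl).
    have [d Md] := vP x; rewrite -[x](subrK (\sum_(i < n) d i *: v i)).
    rewrite lieDl (linD fl) fML // add0r (lin_sum (lie_lin_l y)) (lin_sum fl).
    rewrite big1 ?oppr0 // => i _; rewrite lieZl (linZ fl).
    rewrite /y (lin_sum (lie_lin_r (v i))) (lin_sum fl).
    have : (B *m cokermx B) i j = 0 by rewrite mulmx_coker mxE.
    rewrite mxE => Bc; rewrite [X in d i *: X](_ : _ = 0) ?scaler0 // -[RHS]Bc.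
    by apply: eq_bigr => k _; rewrite lieZr (linZ fl) mxE mulrC.
  have : f y = 0 by apply: fM0; rewrite -SM.
  rewrite /y (lin_sum fl) => fy; rewrite -[RHS]fy; apply: eq_bigr => k _.
  by rewrite (linZ fl) mxE mulrC.
pose w := \sum_(i < n) r 0 i *: v i.
have fw y : f (lie w y) = f y.
  have [d Md] := vP y; rewrite -[y](subrK (\sum_(i < n) d i *: v i)).
  rewrite lieDr [LHS](linD fl) [RHS](linD fl) fLM // (fM0 _ Md); congr (_ + _).
  rewrite (lin_sum (lie_lin_r w)) !(lin_sum fl); apply: eq_bigr => j _.
  rewrite lieZr !(linZ fl); congr (_ *: _).
  have := congr1 (fun A : 'rV[K]_n => A 0 j) phiE; rewrite !mxE => ->.
  rewrite /w (lin_sum (lie_lin_l _)) (lin_sum fl); apply: eq_bigr => i _.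
  by rewrite lieZl (linZ fl) mxE.
have Mw m : M m -> M (lie m w).
  move=> Mm; rewrite -SM => y.
  have -> : lie (lie m w) y = lie m (lie w y) - lie w (lie m y).
    by rewrite [lie m (lie _ _)]lie_derivation; lincomb R[i].
  by rewrite (linB fl) fw !fML // subrr.
have sMw := subspace_addl sM w.
have /seteqP[_ TMw] : addl M w = setT.
  apply: contrapT => nT.
  have MwE : addl M w = M.
    apply: Mmax => //; first exact: closed_addl.
      apply: linear_subalgebra => // _ _ [c [m [Mm ->]]] [c' [m' [Mm' ->]]].
      exists 0, (lie m m' + c' *: lie m w - c *: lie m' w); split.
        apply: (subB sM); last by apply: (subZ sM); exact: Mw.
        by apply: (subD sM); [exact: MM|apply: (subZ sM); exact: Mw].
      rewrite !lieDl !lieDr !lieZl !lieZr lie_alt (lieC w m'); lincomb R[i].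
    exact: sub_addl.
  apply: fx0; rewrite -fw; apply: fML; rewrite -MwE; exact: addl_self.
have [c [m [Mm x0E]]] := TMw x0 I.
by case: fx0; rewrite x0E (linD fl) (linZ fl) (fM0 m Mm) -(fw w) lie_alt (lin0 fl) scaler0 addr0.
Qed.

Theorem maximal_subalgebra_ideal :
  exists I, [/\ closed I, lie_ideal I, finite_codim I & I `<=` M].
Proof.
have [[n n0 Fn]|noF] := pselect (exists2 n, (0 < n)%N & filt M n `<=` filt M n.+1).
  have sF := filt_sub sM n.
  exists (filt M n); split.
  - exact: filt_closed.
  - by case: (sF) => F0 Fl; split=> // x y /Fn; exact: filt_lie.
  - exact: filt_codim.
  - by move=> x /(filt_le n0)/filt1.
have [P [sP MP [k kP] Pmax]] := max_kills sM fM MM.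
have PT : P <> setT.
  (* If P = L, words of k letters send step k into [M], so the chain is already stable at step k +
     1. *)
  move=> PT; apply: noF; exists k.+1 => // z Fz s; rewrite ltnS leq_eqVlt.
  move=> /orP[/eqP sk|]; last exact: Fz.
  case/lastP: s sk => // s y; rewrite size_rcons => -[sk].
  rewrite -cats1 word_cat; apply: kP => // [u _|]; first by rewrite PT.
  exact: filt_lie.
have [f [fl f0 fM0 fML]] := invariant_functional sP MP kP Pmax PT.
by exists M; split=> //; exact: invariant_functional_ideal fl f0 fM0 fML.
Qed.

End MaximalSubalgebra.

(** * The families and their intersections *)

Section Families.
Context {R : realType}.
Local Notation K := R[i].
Implicit Types L : banachLieType K.

Lemma closedSubalg_subspace L (A : closedSubalg L) : linear_subspace (A : set L).
Proof. by have [] := closedSubalgP A. Qed.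

Lemma closedSubalg_lie L (A : closedSubalg L) x y :
  (A : set L) x -> (A : set L) y -> (A : set L) (lie x y).
Proof. by have [_ _] := closedSubalgP A; apply. Qed.

Lemma ideal_subalgebra L (A : set L) : lie_ideal A -> lie_subalgebra A.
Proof. by move=> [A0 Al Ab]; split=> // x y _; exact: Ab. Qed.

Lemma maximal_above L (F : set (closedSubalg L)) A : F `<=` familyS L -> F A ->
  exists2 M, maximal_members F M & A `<=` M.
Proof.
move=> FS FA; have [_ fA] := FS _ FA; have sA := closedSubalg_subspace A.
pose Phi := [set B : set L | exists C : closedSubalg L, [/\ F C, A `<=` C & B = C]].
have PhiS B : Phi B -> linear_subspace B /\ (A : set L) `<=` B.
  by move=> [C [_ AC ->]]; split=> //; exact: closedSubalg_subspace.
have PhiA : Phi A by exists A; split=> // x.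
have [_ [[M [FM AM ->]] _ Mmax]] := max_subspace sA fA PhiS PhiA.
exists M => //; split=> // C FC MC; apply: closedSubalg_eq; apply: Mmax => //.
by exists C; split=> //; exact: subset_trans AM MC.
Qed.

Lemma familyJ_S L : familyJ L `<=` familyS L.
Proof. by move=> A []. Qed.

Lemma Smax_contains_J L (M : closedSubalg L) : familySmax L M ->
  exists2 I : closedSubalg L, familyJ L I & I `<=` M.
Proof.
move=> [[MT fM] Mmax].
have [|I [cI aI fI IM]] := maximal_subalgebra_ideal (@closedSubalg_closed _ _ M) (closedSubalgP M) fM.
  move=> B cB aB MB BT.
  rewrite -(Mmax (ClosedSubalg cB aB)) //; split; first exact/eqP.
  exact: finite_codim_sub fM.
exists (ClosedSubalg cI (ideal_subalgebra aI)) => //; split=> //=; apply/eqP => IT.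
by move/eqP: MT; apply; apply/seteqP; split=> // x _; apply: IM; rewrite IT.
Qed.

(** A subalgebra lies in a maximal one, which contains an ideal, which lies in a maximal ideal, all
    of finite codimension. *)
Lemma Jmax_nonempty L : familyS L !=set0 -> familyJmax L !=set0.
Proof.
move=> [A SA]; have [M Mmax _] := maximal_above (@subset_refl _ _) SA.
have [I JI _] := Smax_contains_J Mmax.
by have [J Jmax _] := maximal_above (@familyJ_S L) JI; exists J.
Qed.

Lemma in_inter L (F : set (closedSubalg L)) x :
  (subalg_inter F : set L) x <-> forall A, F A -> (A : set L) x.
Proof. by []. Qed.

Lemma in_P (Gamma : forall L, set (closedSubalg L)) L x :
  (P_ Gamma L : set L) x <-> forall A, Gamma L A -> (A : set L) x.
Proof. by []. Qed.

Lemma P_S_J L : P_ familyS L `<=` P_ familyJ L.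
Proof. by move=> x Sx; apply/in_P => A /familyJ_S; exact: Sx. Qed.

Lemma P_J_Smax L : P_ familyJ L `<=` P_ familySmax L.
Proof. by move=> x Jx; apply/in_P => M /Smax_contains_J[I JI IM]; exact: IM (Jx I JI). Qed.

Lemma P_Jmax_proper L : familyS L !=set0 -> (P_ familyJmax L : set L) <> setT.
Proof.
move=> /Jmax_nonempty[N JN] PT; have [[/eqP NT _ _] _] := JN; apply: NT.
apply/seteqP; split=> // x _; have : (P_ familyJmax L : set L) x by rewrite PT.
exact.
Qed.

(** * Preimages under bounded homomorphisms and functoriality *)

Section Preimage.
Context {L1 L2 : banachLieType K} (f : L1 -> L2) (c : K).
Hypotheses (fh : lie_hom f) (c0 : 0 <= c) (fc : bounded_by c f).
Variable A : closedSubalg L2.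
Let pre := [set x | (A : set L2) (f x)].

Let pre_closed : closed pre.
Proof.
apply: (closed_preim c0 _ (@closedSubalg_closed _ _ A)) => x y.
by rewrite -(linB fh.1); exact: fc.
Qed.

Let pre_subalgebra : lie_subalgebra pre.
Proof.
have [p0 pl] := subspace_preim fh.1 (closedSubalg_subspace A); split=> // x y Ax Ay.
by rewrite /pre /= fh.2; exact: closedSubalg_lie.
Qed.

Definition preim_subalg : closedSubalg L1 := ClosedSubalg pre_closed pre_subalgebra.

Lemma preim_codim : finite_codim A -> finite_codim preim_subalg.
Proof.
move=> fA; have [n [g [gl gP]]] := finite_codim_kernel (closedSubalg_subspace A) fA.
apply: (@kernel_finite_codim _ _ _ _ (g \o f)) => [a x y|x /= /gP //].
by rewrite /= fh.1 gl.
Qed.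

Lemma preim_ideal : lie_ideal A -> lie_ideal preim_subalg.
Proof.
move=> [A0 Al Ab]; have [p0 pl _] := pre_subalgebra; split=> // x y Ay.
by rewrite /= /pre /= fh.2; exact: Ab.
Qed.

End Preimage.

Section Functoriality.
Context {L1 L2 : banachLieType K} (f : L1 -> L2) (c : K).
Hypotheses (fh : lie_hom f) (c0 : 0 <= c) (fc : bounded_by c f).
Local Notation pre := (preim_subalg fh c0 fc).

(** The preimage of a member of the family is either a member or all of [L1]. *)
Lemma P_S_functorial x : (P_ familyS L1 : set L1) x -> (P_ familyS L2 : set L2) (f x).
Proof.
move=> Px; apply/in_P => A [AT fA].
have [pT|pT] := pselect ((pre A : set L1) = setT).
  by have : (pre A : set L1) x by rewrite pT.
by apply: (Px (pre A)); split; [exact/eqP|exact: preim_codim].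
Qed.

Lemma P_J_functorial x : (P_ familyJ L1 : set L1) x -> (P_ familyJ L2 : set L2) (f x).
Proof.
move=> Px; apply/in_P => A [AT fA iA].
have [pT|pT] := pselect ((pre A : set L1) = setT).
  by have : (pre A : set L1) x by rewrite pT.
by apply: (Px (pre A)); split; [exact/eqP|exact: preim_codim|exact: preim_ideal].
Qed.

Let codim_add (N : closedSubalg L2) (B : set L1) : linear_subspace B ->
  linear_subspace [set y | exists b n, [/\ B b, (N : set L2) n & y = f b + n]].
Proof.
move=> sB; have sN := closedSubalg_subspace N; split.
  exists 0, 0; rewrite (lin0 fh.1) addr0.
  by split=> //; [exact: sub0 sB|exact: sub0 sN].
move=> a _ _ [x [n [Bx Nn ->]]] [y [m [By Nm ->]]].
exists (a *: x + y), (a *: n + m); split; [exact: sB.2|exact: sN.2|].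
by rewrite fh.1; lincomb R[i].
Qed.

(* For a maximal ideal N not containing f(L1), L2 = f(L1) + N and
   L1 / f^-1(N) = L2 / N. *)
Lemma P_Jmax_functorial x : (forall y z, exists u, lie y (f z) = f u) ->
  (P_ familyJmax L1 : set L1) x -> (P_ familyJmax L2 : set L2) (f x).
Proof.
move=> fideal Px; apply/in_P => N [[NT fN iN] Nmax].
have sN := closedSubalg_subspace N; have cN := @closedSubalg_closed _ _ N.
have [_ _ Nb] := iN.
pose plus (B : set L1) := [set y | exists b n, [/\ B b, (N : set L2) n & y = f b + n]].
have Nplus B : linear_subspace B -> N `<=` plus B.
  by move=> sB n Nn; exists 0, n; rewrite (lin0 fh.1) add0r; split=> //; exact: sub0 sB.
have plus_max B : linear_subspace B -> (forall y z, B z -> plus B (lie y (f z))) ->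
    plus B <> setT -> plus B = N.
  move=> sB Bb BT; have sBN := codim_add N sB.
  have cBN : closed (plus B) by exact: closed_sup sN cN fN sBN (Nplus B sB).
  have iBN : lie_ideal (plus B).
    case: (sBN) => p0 pl; split=> // y _ [b [n [Bb' Nn ->]]].
    rewrite lieDr; apply: (subD sBN); first exact: Bb.
    by apply: (Nplus B sB); exact: Nb.
  rewrite -(Nmax (ClosedSubalg cBN (ideal_subalgebra iBN))) //.
    split=> //; first exact/eqP.
    exact: finite_codim_sub (Nplus B sB) fN.
  exact: Nplus.
have [fTN|nfTN] := pselect (forall y, (N : set L2) (f y)); first exact: fTN.
have /seteqP[_ Tplus] : plus setT = setT.
  apply: contrapT => pT; apply: nfTN => y.
  rewrite -(plus_max setT) //.
    by exists y, 0; rewrite addr0; split=> //; exact: sub0 sN.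
  move=> u z _; have [v ->] := fideal u z; exists v, 0.
  by rewrite addr0; split=> //; exact: sub0 sN.
apply: (Px (pre N)); split.
  split; [|exact: preim_codim|exact: preim_ideal].
  by apply/eqP => pT; apply: nfTN => y; have : (pre N : set L1) y by rewrite pT.
move=> C [/eqP CT fC iC] NC; have sC := closedSubalg_subspace C; have [_ _ Cb] := iC.
(* f(C) + N is an ideal because L2 = f(L1) + N, and it is proper because C is proper and contains
   the preimage of N; maximality of N applies. *)
have pC : plus C = N.
  apply: plus_max => // [y z Cz|CNT].
    have [a [n [_ Nn ->]]] := Tplus y I; rewrite lieDl -fh.2.
    exists (lie a z), (lie n (f z)); split=> //; first exact: Cb.
    by rewrite lieC; apply: (subN sN); exact: Nb.
  apply: CT; apply/seteqP; split=> // a _.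
  have [z [n [Cz Nn fa]]] : plus C (f a) by rewrite CNT.
  rewrite -(subrK z a); apply: (subD sC) => //; apply: NC => /=.
  by rewrite (linB fh.1) fa addrC addKr.
apply: closedSubalg_eq; apply/seteqP; split=> // z Cz /=.
by rewrite -pC; exists z, 0; rewrite addr0; split=> //; exact: sub0 sN.
Qed.

End Functoriality.

(** * Invariance of maximal subalgebras under automorphisms *)

Section Automorphisms.
Context {L : banachLieType K}.

Lemma preim_Smax (E E' : L -> L) (c : K) (Eh : lie_hom E) (E'h : lie_hom E')
  (c0 : 0 <= c) (Eb : bounded_by c E) (E'b : bounded_by c E') A :
  cancel E E' -> cancel E' E -> familySmax L A -> familySmax L (preim_subalg Eh c0 Eb A).
Proof.
move=> EK E'K [[/eqP AT fA] Amax]; split.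
  split; last exact: preim_codim.
  apply/eqP => pT; apply: AT; apply/seteqP; split=> // y _.
  have : (preim_subalg Eh c0 Eb A : set L) (E' y) by rewrite pT.
  by rewrite /= E'K.
move=> B [/eqP BT fB] AB; pose C := preim_subalg E'h c0 E'b B.
have CA : C = A.
  apply: Amax => [|y Ay /=]; last by apply: AB; rewrite /= E'K.
  split; last exact: preim_codim.
  apply/eqP => pT; apply: BT; apply/seteqP; split=> // y _.
  have : (C : set L) (E y) by rewrite pT.
  by rewrite /= EK.
apply: closedSubalg_eq; apply/seteqP; split=> // y By /=.
by rewrite -CA /= EK.
Qed.

(** The flow of [D] preserves [Z], hence pulls maximal subalgebras containing [Z] back to such
    subalgebras; their intersection is stable under the flow, and so under [D]. *)
Lemma Smax_derivation (D : L -> L) b (Z : set L) : derivation D -> 0 <= b ->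
  bounded_by b D ->
  (forall (s : K) E E', flow (fun x => s *: D x) E E' -> forall z, Z z -> Z (E z)) ->
  forall x, (forall A, familySmax L A -> Z `<=` A -> (A : set L) x) ->
  forall A, familySmax L A -> Z `<=` A -> (A : set L) (D x).
Proof.
move=> Dd b0 Db ZE.
pose I := subalg_inter [set A | familySmax L A /\ Z `<=` A].
suff H x : (I : set L) x -> (I : set L) (D x).
  move=> x Ix A SA ZA; apply: ((in_inter _ _).1 (H x _)); last by split.
  by apply/in_inter => B [SB ZB]; exact: Ix.
apply: (derivation_invariant (closedSubalg_subspace I) (@closedSubalg_closed _ _ I) Dd b0 Db).
move=> s E E' sE z Iz; apply/in_inter => A [SA ZA]; have [[Eh E'h] [EK E'K] [Eb E'b] _] := sE.
have two0 : 0 <= 2 :> K by [].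
apply: (Iz (preim_subalg Eh two0 Eb A)); split.
  exact: (preim_Smax Eh E'h two0 Eb E'b EK E'K).
by move=> y Zy; apply: ZA; exact: ZE sE _ Zy.
Qed.

Lemma lie_bounded_by (h : L) : exists2 b : K, 0 <= b & bounded_by b (lie h).
Proof.
have [t t0 tP] := @lie_bounded K L.
by exists (t * `|h|); [rewrite mulr_ge0 // ltW|exact: tP].
Qed.

(** For a maximal ideal N, the intersection I of the maximal subalgebras containing N is an ideal,
    since the flow of ad h preserves N. It is proper, as N lies in at least one of them, so I =
    N. *)
Lemma P_Smax_Jmax : P_ familySmax L `<=` P_ familyJmax L.
Proof.
move=> x Sx; apply/in_P => N [[NT fN iN] Nmax]; have [_ _ Nb] := iN.
pose I := subalg_inter [set A | familySmax L A /\ N `<=` A].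
have NI : N `<=` I by move=> y Ny; apply/in_inter => A [_]; exact.
have iI : lie_ideal I.
  have [I0 Il _] := closedSubalgP I; split=> // h y Iy; apply/in_inter => A [SA NA].
  have [b b0 hb] := lie_bounded_by h.
  apply: (Smax_derivation (lie_is_derivation h) b0 hb) SA NA.
    move=> s E E' [_ _ _ Est] z Nz.
    have sN := closedSubalg_subspace N.
    have DN u : (N : set L) u -> (N : set L) (s *: lie h u).
      by move=> Nu; apply: (subZ sN); exact: Nb.
    by have [] := Est N z sN (@closedSubalg_closed _ _ N) DN Nz.
  by move=> A' SA' NA'; apply: ((in_inter _ _).1 Iy).
have fI : finite_codim I by exact: finite_codim_sub NI fN.
have IT : (I : set L) != setT.
  have SN : familyS L N by split.
  have [M SM NM] := maximal_above (@subset_refl _ _) SN.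
  have [[/eqP MT _] _] := SM; apply/eqP => IT; apply: MT.
  apply/seteqP; split=> // y _; have : (I : set L) y by rewrite IT.
  by apply; split.
have <- : I = N by apply: Nmax.
by apply/in_inter => A [SA _]; exact: Sx.
Qed.

End Automorphisms.
End Families.

(** * Transfinite iterates *)

Section Inclusion.
Context {K : numFieldType} {L : banachLieType K}.
Variables A B : closedSubalg L.
Hypothesis AB : (A : set L) `<=` B.

Definition incl (x : subalg_type A) : subalg_type B :=
  exist _ (val x) (mem_set (AB (subalg_valP x))).

Lemma incl_hom : lie_hom incl.
Proof.
split=> [a x y|x y]; apply: val_inj; last by [].
exact: erefl.
Qed.

Lemma incl_bounded : bounded_by 1 incl.
Proof. by move=> x; rewrite mul1r. Qed.

End Inclusion.

Section Iterates.
Context {K : numFieldType} {L : banachLieType K}.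
Implicit Types S T : lieMap K.

Lemma map_on_le S T (A B : closedSubalg L) (AB : (A : set L) `<=` B) :
  (forall x, (S (subalg_type A) : set _) x ->
     (T (subalg_type B) : set (subalg_type B)) (incl AB x)) ->
  map_on S A `<=` map_on T B.
Proof. by move=> ST _ [x Sx <-]; exists (incl AB x) => //; exact: ST. Qed.

(** The clause for intersections also covers the ordinal 0, through the empty family. *)
Lemma iter_pow_ind S (Q : set L -> Prop) :
  (forall A : closedSubalg L, Q A -> Q (map_on S A)) ->
  (forall F : set (closedSubalg L), (forall A, F A -> Q A) ->
     Q [set v | forall A, F A -> (A : set L) v]) ->
  forall a, Q (iter_pow S L a).
Proof.
move=> Qs Ql a; elim: (ord_lt_wf a) => {}a _ IH.
have [[b ab]|nb] := pselect (exists b, a = ord_succ b).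
  by rewrite ab iter_pow_succ; apply/Qs/IH; rewrite ab; exact: ord_lt_succ.
rewrite iter_pow_limit => [|b ab]; last by apply: nb; exists b.
rewrite (_ : mkset _ = [set v | forall A, [set A | exists2 b, ord_lt b a & A = iter_pow S L b] A ->
  (A : set L) v]).
  by apply: Ql => _ [b ba ->]; exact: IH.
apply/seteqP; split=> v h; first by move=> _ [b ba ->]; exact: h.
by move=> b ba; apply: h; exists b.
Qed.

(** The hypothesis compares the maps only on iterates of [S], so that special properties of these,
    such as being ideals, can be used. *)
Lemma iter_pow_le S T :
  (forall a (B : closedSubalg L), iter_pow S L a `<=` B ->
     map_on S (iter_pow S L a) `<=` map_on T B) ->
  forall a, iter_pow S L a `<=` iter_pow T L a.
Proof.
move=> ST a; elim: (ord_lt_wf a) => {}a _ IH.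
have [[b ab]|nb] := pselect (exists b, a = ord_succ b).
  by rewrite ab !iter_pow_succ; apply/ST/IH; rewrite ab; exact: ord_lt_succ.
have lim b : a <> ord_succ b by move=> ab; apply: nb; exists b.
rewrite (iter_pow_limit S L lim) (iter_pow_limit T L lim).
by move=> v h b ba; apply: IH => //; exact: h.
Qed.

Lemma iter_stable_fixed S : map_on S (iter_stable S L) = iter_stable S L.
Proof. by rewrite /iter_stable -iter_pow_succ; case: (stab_indexP S L). Qed.

(** If b is the index of [T], then S^b is inside T^b, the stable term of [T], hence inside the
    stable term of [S], which is inside S^(b+1). So the chain of [S] is stable at b. *)
Lemma stab_index_le S T :
  (forall a, iter_pow S L a `<=` iter_pow T L a) ->
  iter_stable T L `<=` iter_stable S L ->
  (forall a, iter_stable S L `<=` iter_pow S L a) ->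
  ord_le (stab_index S L) (stab_index T L).
Proof.
move=> ST TS Smin; have [_] := stab_indexP S L; apply.
apply: closedSubalg_eq; apply/seteqP; split.
  by rewrite iter_pow_succ; exact: map_on_sub.
by move=> v /ST/TS; exact: Smin.
Qed.

End Iterates.

(** * Comparison of the four transfinite chains *)

Section Comparison.
Context {R : realType}.
Local Notation K := R[i].
Variable L : banachLieType K.

(** For x in L and an ideal A, ad x restricts to a bounded derivation of A, which preserves the
    intersection of the maximal subalgebras of A. [P_Jmax_functorial] needs such ideals. *)
Lemma ideal_iter_Smax a : lie_ideal (iter_pow (P_ familySmax) L a : set L).
Proof.
apply: (@iter_pow_ind _ L (P_ familySmax) lie_ideal) => [A iA|F Fi]; last first.
  split=> [A /Fi[]//|c x y Fx Fy A FA|x y Fy A FA]; have [_ Al Ab] := Fi A FA.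
    by apply: Al; [exact: Fx|exact: Fy].
  by apply: Ab; exact: Fy.
have [A0 Al Ab] := iA.
have [p0 pl _] := closedSubalgP (map_on (P_ familySmax) A); split=> // x _ [y Sy <-].
pose D (z : subalg_type A) : subalg_type A :=
  exist _ (lie x (val z)) (mem_set (Ab x _ (subalg_valP z))).
have Dd : derivation D.
  split=> [c u v|u v]; apply: val_inj => /=; rewrite ?linearP /= ?subalg_lieE.
    by rewrite lie_linearr.
  exact: lie_derivation.
have [b b0 xb] := lie_bounded_by x.
have Db : bounded_by b D by move=> z; exact: xb.
exists (D y) => //; apply/in_P => N SN.
by apply: (Smax_derivation Dd b0 Db (Z := set0) _ _ SN) => // N' SN' _; exact: Sy.
Qed.

Lemma iter_S_J a : iter_pow (P_ familyS) L a `<=` iter_pow (P_ familyJ) L a.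
Proof.
apply: iter_pow_le => {}a B AB; apply: map_on_le (AB) _ => x Sx.
by apply/P_S_J; exact: (P_S_functorial (incl_hom AB) ler01 (incl_bounded AB)).
Qed.

Lemma iter_J_Smax a : iter_pow (P_ familyJ) L a `<=` iter_pow (P_ familySmax) L a.
Proof.
apply: iter_pow_le => {}a B AB; apply: map_on_le (AB) _ => x Sx.
by apply/P_J_Smax; exact: (P_J_functorial (incl_hom AB) ler01 (incl_bounded AB)).
Qed.

Lemma iter_Smax_Jmax a : iter_pow (P_ familySmax) L a `<=` iter_pow (P_ familyJmax) L a.
Proof.
apply: iter_pow_le => {}a B AB; apply: map_on_le (AB) _ => x /P_Smax_Jmax Jx.
apply: (P_Jmax_functorial (incl_hom AB) ler01 (incl_bounded AB)) Jx.
move=> y z; have [_ _ Ab] := ideal_iter_Smax a.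
exists (exist _ (lie (val y) (val z)) (mem_set (Ab _ _ (subalg_valP z)))).
exact: val_inj.
Qed.

(** When Q lies in an iterate A, a member of the family of A meets Q in a closed subalgebra of
    finite codimension in Q, hence in all of Q; thus Q survives the next step. *)
Lemma no_S_below (Q : closedSubalg L) (Gamma : forall L : banachLieType K, set (closedSubalg L)) :
  (forall L, Gamma L `<=` familyS L) -> ~ (familyS (subalg_type Q) !=set0) ->
  forall a, Q `<=` iter_pow (P_ Gamma) L a.
Proof.
move=> GS nS; apply: iter_pow_ind => [A QA|F FQ v Qv A FA]; last exact: FQ.
move=> v Qv; pose u : subalg_type Q := exist _ v (mem_set Qv).
exists (incl QA u) => //; apply/in_P => N /GS[NT fN].
have [pT|pT] := pselect ((preim_subalg (incl_hom QA) ler01 (incl_bounded QA) N : set _) = setT).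
  by have : (preim_subalg (incl_hom QA) ler01 (incl_bounded QA) N : set _) u by rewrite pT.
case: nS; exists (preim_subalg (incl_hom QA) ler01 (incl_bounded QA) N).
by split; [exact/eqP|exact: preim_codim].
Qed.

(** The stable term Q satisfies P(Q) = Q, so the intersection of its maximal ideals is also Q, which
    [P_Jmax_proper] excludes if Q has a proper closed subalgebra of finite codimension. *)
Lemma iter_stable_no_S (Gamma : forall L : banachLieType K, set (closedSubalg L)) :
  (forall L, P_ Gamma L `<=` P_ familyJmax L) ->
  ~ (familyS (subalg_type (iter_stable (P_ Gamma) L)) !=set0).
Proof.
move=> GJ /P_Jmax_proper; apply; apply/seteqP; split=> // x _; apply: GJ.
set Q := iter_stable _ _ in x *.
have : (map_on (P_ Gamma) Q : set L) (val x) by rewrite iter_stable_fixed; exact: subalg_valP.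
by move=> [y Py /val_inj <-].
Qed.

Lemma iter_stable_eq (Gamma Gamma' : forall L : banachLieType K, set (closedSubalg L)) :
  (forall L, Gamma L `<=` familyS L) -> (forall L, Gamma' L `<=` familyS L) ->
  (forall L, P_ Gamma L `<=` P_ familyJmax L) ->
  (forall L, P_ Gamma' L `<=` P_ familyJmax L) ->
  iter_stable (P_ Gamma) L = iter_stable (P_ Gamma') L.
Proof.
move=> GS G'S GJ G'J; apply: closedSubalg_eq; apply/seteqP.
by split; apply: no_S_below => //; exact: iter_stable_no_S.
Qed.

End Comparison.

Theorem theorem7p8 (R : realType) :
  (* (i) *)
  [/\ (forall L : banachLieType R[i],
         [/\ P_ familyS L `<=` P_ familyJ L,
             P_ familyJ L `<=` P_ familySmax L &
             P_ familySmax L `<=` P_ familyJmax L])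
      /\ [/\ lieMap_le (P_ (@familyS R[i])) (P_ familyJ),
             lieMap_le (P_ (@familyJ R[i])) (P_ familySmax) &
             lieMap_le (P_ (@familySmax R[i])) (P_ familyJmax)]
      /\ (forall L : banachLieType R[i],
            familyS L !=set0 -> (P_ familyJmax L : set L) <> setT),
  (* (ii) *)
      forall L : banachLieType R[i],
        [/\ iter_stable (P_ familyS) L = iter_stable (P_ familyJ) L,
            iter_stable (P_ familyJ) L = iter_stable (P_ familySmax) L &
            iter_stable (P_ familySmax) L = iter_stable (P_ familyJmax) L]
  (* (iii) *)
    & forall L : banachLieType R[i],
        [/\ ord_le (stab_index (P_ familyS) L) (stab_index (P_ familyJ) L),
            ord_le (stab_index (P_ familyJ) L) (stab_index (P_ familySmax) L) &
            ord_le (stab_index (P_ familySmax) L)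
                   (stab_index (P_ familyJmax) L)]].
Proof.
have JS (L : banachLieType R[i]) : familyJ L `<=` familyS L := @familyJ_S R L.
have SmS (L : banachLieType R[i]) : familySmax L `<=` familyS L by move=> A [].
have JmS (L : banachLieType R[i]) : familyJmax L `<=` familyS L by move=> A [/JS].
have SS (L : banachLieType R[i]) : familyS L `<=` familyS L by [].
have JmJ (L : banachLieType R[i]) : P_ familyJmax L `<=` P_ familyJmax L by [].
have SmJ (L : banachLieType R[i]) := @P_Smax_Jmax R L.
have JJ (L : banachLieType R[i]) : P_ familyJ L `<=` P_ familyJmax L.
  by move=> x /P_J_Smax; exact: SmJ.
have SJ (L : banachLieType R[i]) : P_ familyS L `<=` P_ familyJmax L.
  by move=> x /P_S_J; exact: JJ.
have stable (L : banachLieType R[i]) := (@iter_stable_eq R L _ _ SS JS SJ JJ,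
  @iter_stable_eq R L _ _ JS SmS JJ SmJ, @iter_stable_eq R L _ _ SmS JmS SmJ JmJ).
split.
- split=> [L|]; first by split; [exact: P_S_J|exact: P_J_Smax|exact: P_Smax_Jmax].
  by split; [split=> L; [exact: P_S_J|exact: P_J_Smax|exact: P_Smax_Jmax]|exact: P_Jmax_proper].
- by move=> L; have [[? ?] ?] := stable L; split.
move=> L; have [[e1 e2] e3] := stable L.
split; apply: stab_index_le.
- exact: iter_S_J.
- by rewrite e1.
- by move=> a; apply: no_S_below => //; exact: iter_stable_no_S.
- exact: iter_J_Smax.
- by rewrite e2.
- by move=> a; apply: no_S_below => //; exact: iter_stable_no_S.
- exact: iter_Smax_Jmax.
- by rewrite e3.
by move=> a; apply: no_S_below => //; exact: iter_stable_no_S.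
Qed.
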